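(* Let $\mathbf{M}$ be a compact smooth $m$-dimensional submanifold without boundary of $\mathbf{R}^s$, with cutlocus $\mathbf{C}$ and nearest-point map $\pi$. Let $t\in\mathbf{R}^s$ with $t\notin\mathbf{C}$, put $\mu=\pi(t)$ and $G=\mathrm{I}_s-A_{t-\mu}\tan_\mu$. Let $\tilde t_n$ be random vectors in $\mathbf{R}^s$, $a_n\to\infty$ positive numbers and $V$ a positive definite $s\times s$ matrix such that $$Z_n=a_nV^{-1/2}(\tilde t_n-t)\xrightarrow{\mathcal D}Z$$ for some random vector $Z$ in $\mathbf{R}^s$; put $\tilde\mu_n=\pi(\tilde t_n)$. Then: 1. $\|\tilde\mu_n-\mu\|\to0$ in probability. If moreover $Z$ is spherical, then: 2. $a_n(\mathrm{nor}_\mu+\tan_\mu V\tan_\mu)^{-1/2}G(\tilde\mu_n-\mu)=\big((\mathrm{nor}_\mu+\tan_\mu V\tan_\mu)^{-1/2}\tan_\mu V^{1/2}\big)Z_n+o_P(1)\xrightarrow{\mathcal D}\tan_\mu Z$; 3. $a_n^2(\tilde\mu_n-\mu)^TG(\mathrm{nor}_\mu+\tan_\mu V\tan_\mu)^{-1}G(\tilde\mu_n-\mu)\xrightarrow{\mathcal D}\zeta_m^2$, where $\zeta_m^2$ does not depend on $\mu$.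
   Context: Cutlocus $\mathbf{C}$: set of $x\in\mathbf{R}^s$ for which the minimizer of $\mu\mapsto\|\mu-x\|^2$ over $\mathbf{M}$ is non-unique or has degenerate Hessian; $\pi(x)=\arg\min_{\mu\in\mathbf{M}}\|\mu-x\|$ for $x\notin\mathbf{C}$. $\tan_\mu$, $\mathrm{nor}_\mu=\mathrm{I}_s-\tan_\mu$: orthogonal projections onto tangent space $T_\mu\mathbf{M}$ and normal space $N_\mu\mathbf{M}$ (as subspaces of $\mathbf{R}^s$). For $v\in N_\mu\mathbf{M}$, the Weingarten map is $A_v(w)=-\tan_\mu(D_w\nu)$, $w\in T_\mu\mathbf{M}$, where $\nu$ is any smooth normal vector field along $\mathbf{M}$ with $\nu(\mu)=v$. Matrix square roots are symmetric positive definite ones. $Z$ spherical: $HZ\overset{\mathcal D}{=}Z$ for all orthogonal $H$; $\zeta_m^2$ is the distribution of $\sum_{i=1}^mZ_i^2$ where $Z=(Z_1,\dots,Z_s)$. $o_P(1)$: term tending to $0$ in probability. *)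

(* Defs.v *)
From HB Require Import structures.
From mathcomp Require Import all_boot all_order all_algebra.
From mathcomp Require Import all_classical all_reals all_analysis.
Set Implicit Arguments. Unset Strict Implicit. Unset Printing Implicit Defensive.
Import Order.TTheory GRing.Theory Num.Theory.
Import numFieldNormedType.Exports.
Local Open Scope classical_set_scope.
Local Open Scope ring_scope.

Definition dotv {R : realType} {s : nat} (x y : 'cV[R]_s) : R := (x^T *m y) 0 0.
Definition enorm {R : realType} {s : nat} (x : 'cV[R]_s) : R := Num.sqrt (dotv x x).

Fixpoint iter_deriv {R : realType} {V W : normedModType R}
  (f : V -> W) (vs : seq V) : V -> W :=
  match vs with
  | [::] => f
  | v :: vs' => fun x => 'D_v (iter_deriv f vs') x
  end.

Definition smooth {R : realType} {V W : normedModType R} (f : V -> W) : Prop :=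
  forall vs : seq V,
    (forall (v x : V), derivable (iter_deriv f vs) x v) /\
    continuous (iter_deriv f vs).

Definition submanifold {R : realType} (s m : nat) (M : set 'cV[R]_s) : Prop :=
  (m <= s)%N /\
  forall p, M p ->
    exists (U : set 'cV[R]_s) (F : 'cV[R]_s -> 'cV[R]_(s - m)),
      [/\ open U, U p, smooth F,
          (forall x, U x -> (M x <-> F x = 0)) &
          (forall x, U x -> M x -> forall y : 'cV[R]_(s - m),
               exists v : 'cV[R]_s, 'D_v F x = y)].

Definition tangent_space {R : realType} {s : nat} (M : set 'cV[R]_s)
  (mu : 'cV[R]_s) : set 'cV[R]_s :=
  [set v | exists g : R -> 'cV[R]_s,
     [/\ smooth g, (forall r, M (g r)), g 0 = mu & 'D_1 g 0 = v]].

Definition is_tan_proj {R : realType} {s : nat} (M : set 'cV[R]_s)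
  (mu : 'cV[R]_s) (P : 'M[R]_s) : Prop :=
  [/\ P^T = P, P *m P = P &
      forall v, tangent_space M mu v <-> P *m v = v].

Definition nearest {R : realType} {s : nat} (M : set 'cV[R]_s)
  (x mu : 'cV[R]_s) : Prop :=
  M mu /\ forall y, M y -> enorm (mu - x) <= enorm (y - x).

(* Hessian of  nu |-> ||nu - x||^2  on M at mu, evaluated on (v, w):
   h = d/da d/db ||sigma(a,b) - x||^2 at 0 for smooth two-parameter sigma in M
   with sigma(0) = mu, d_a sigma(0) = v, d_b sigma(0) = w. *)
Definition e2 {R : realType} (i : 'I_2) : 'cV[R]_2 := delta_mx i 0.

Definition hessian_at {R : realType} {s : nat} (M : set 'cV[R]_s)
  (x mu v w : 'cV[R]_s) (h : R) : Prop :=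
  exists sigma : 'cV[R]_2 -> 'cV[R]_s,
    [/\ smooth sigma, (forall z, M (sigma z)), sigma 0 = mu &
        'D_(e2 0) sigma 0 = v /\ 'D_(e2 1) sigma 0 = w] /\
        h = 'D_(e2 0) (fun z => 'D_(e2 1)
                 (fun z' => dotv (sigma z' - x) (sigma z' - x)) z) 0.

Definition hessian_nondeg {R : realType} {s : nat} (M : set 'cV[R]_s)
  (x mu : 'cV[R]_s) : Prop :=
  forall v, tangent_space M mu v ->
    (forall w h, tangent_space M mu w -> hessian_at M x mu v w h -> h = 0) ->
    v = 0.

Definition cutlocus {R : realType} {s : nat} (M : set 'cV[R]_s) : set 'cV[R]_s :=
  [set x | ~ ((exists! mu, nearest M x mu) /\
              (forall mu, nearest M x mu -> hessian_nondeg M x mu))].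

Definition normal_field {R : realType} {s : nat} (M : set 'cV[R]_s)
  (nu : 'cV[R]_s -> 'cV[R]_s) : Prop :=
  smooth nu /\
  forall y, M y -> forall v, tangent_space M y v -> dotv (nu y) v = 0.

Definition weingarten {R : realType} {s : nat} (P : 'M[R]_s)
  (nu : 'cV[R]_s -> 'cV[R]_s) (mu w : 'cV[R]_s) : 'cV[R]_s :=
  - (P *m 'D_w nu mu).

Definition mx_of {R : realType} {s : nat} (f : 'cV[R]_s -> 'cV[R]_s) : 'M[R]_s :=
  \matrix_(i, j) (f (delta_mx j 0)) i 0.

Definition spd {R : realType} {s : nat} (A : 'M[R]_s) : Prop :=
  A^T = A /\ forall x : 'cV[R]_s, x != 0 -> 0 < dotv x (A *m x).

Definition is_sqrtm {R : realType} {s : nat} (A B : 'M[R]_s) : Prop :=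
  spd B /\ B *m B = A.

Definition rand_vec {d} {Omega : measurableType d} {R : realType} {s : nat}
  (X : Omega -> 'cV[R]_s) : Prop :=
  forall i j, measurable_fun setT (fun w => X w i j).

Definition borel {T : topologicalType} : set (set T) := <<s open >>.

Definition cvg_dist {R : realType} {T : topologicalType}
  {d} {Omega : measurableType d} (P : probability Omega R)
  {d'} {Omega' : measurableType d'} (P' : probability Omega' R)
  (X : nat -> Omega -> T) (Y : Omega' -> T) : Prop :=
  forall f : T -> R, continuous f -> (exists C : R, forall x, `|f x| <= C) ->
    (fun n => (\int[P]_w (f (X n w))%:E)%E) @ \oo --> (\int[P']_w (f (Y w))%:E)%E.

Definition cvg_prob0 {R : realType} {d} {Omega : measurableType d}
  (P : probability Omega R) (X : nat -> Omega -> R) : Prop :=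
  forall eps : R, 0 < eps ->
    (fun n => P [set w | eps <= `|X n w|]) @ \oo --> 0%E.

Definition spherical {R : realType} {s : nat} {d} {Omega : measurableType d}
  (P : probability Omega R) (Z : Omega -> 'cV[R]_s) : Prop :=
  forall H : 'M[R]_s, H^T *m H = 1%:M ->
    forall B : set 'cV[R]_s, borel B ->
      P [set w | B (H *m Z w)] = P [set w | B (Z w)].

(* Main.v *)
(* A nearest point [mu'] of [x] makes [x - mu'] normal to [M] at [mu'].  The field [nu] is also normal there, and [nu mu = t - mu], so the first-order expansion of the normal vector [x - mu' - nu mu'], projected to the tangent space at [mu], reads [G (mu' - mu) = Ptan (x - t) + o(|x - t| + |mu' - mu|)].  Off the cutlocus the Hessian of the squared distance is [2 <G v, w>] on tangent vectors, hence [G] is invertible and the remainder is [o(|x - t|)]; compactness of [M] and uniqueness of the nearest point give [mu' -> mu].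

The tangent space at a point of [M] has to be filled with global smooth curves: they solve [F(p + r v + B y(r)) = 0] by Banach's fixed point theorem, where [B] is a right inverse of the Jacobian, and are run at the bounded time [q sin(r / q)].  Symmetry of [G] comes from that of the second derivatives of [F].

With [A = W12^-1 Ptan V12] one has [A A^T = Ptan], so [A = Ptan H] for an orthogonal [H]; sphericity turns [A Z] into [Ptan Z], and, [Ptan] being orthogonally conjugate to [pid_mx m], [|Ptan Z|^2] into the sum of the first [m] squares. *)

Require Import Defs.
From HB Require Import structures.
From mathcomp Require Import all_boot all_order all_algebra.
From mathcomp Require Import all_classical all_reals all_analysis.
From mathcomp Require Import measurable_realfun ring lra.
Set Implicit Arguments.
Unset Strict Implicit.
Unset Printing Implicit Defensive.
Import Order.TTheory GRing.Theory Num.Theory.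
Import numFieldNormedType.Exports.
Local Open Scope classical_set_scope.
Local Open Scope ring_scope.

(** * Orthogonal projectors and matrix square roots *)

(** Two definitions shape the geometric half. [smooth] speaks only of iterated directional
    derivatives, so total differentiability and the chain rule have to be earned from the mean value
    theorem. [tangent_space] asks for curves that stay in [M] for all times, so local solution
    curves must be made global without losing any derivative.

    Invertibility of [G] is read off contrapositively: a kernel vector of [G] is tangent and makes
    every value that [hessian_at] can take vanish.

    The identity [A *m A^T = Ptan] rests on [W12] being the identity on the normal space: there
    [(W12 + 1)(W12 - 1) = Wm - 1 = 0], and [W12 + 1] is invertible.

    Probability enters through tightness only. [Z_n] converges in distribution, hence is tight; on
    [|Z_n| < K] the distance from [tt n] to [t] is at most a constant over [a n], so the
    deterministic remainder [o(|x - t|)] becomes [o(1 / a n)], and the factor [a n] leaves [o(1)] on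
    an event of probability close to one. *)

Section DotProduct.
Context {R : realType} {s : nat}.
Implicit Types (x y z : 'cV[R]_s) (A : 'M[R]_s).

Lemma dotvE x y : dotv x y = \sum_i x i 0 * y i 0.
Proof. by rewrite /dotv mxE; apply: eq_bigr => i _; rewrite mxE. Qed.

Lemma dotvC x y : dotv x y = dotv y x.
Proof. by rewrite !dotvE; apply: eq_bigr => i _; rewrite mulrC. Qed.

Lemma dotvDl x y z : dotv (x + y) z = dotv x z + dotv y z.
Proof. by rewrite /dotv linearD mulmxDl mxE. Qed.

Lemma dotvNl x z : dotv (- x) z = - dotv x z.
Proof. by rewrite /dotv linearN mulNmx mxE. Qed.

Lemma dotvBl x y z : dotv (x - y) z = dotv x z - dotv y z.
Proof. by rewrite dotvDl dotvNl. Qed.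

Lemma dotvZl (k : R) x z : dotv (k *: x) z = k * dotv x z.
Proof. by rewrite /dotv linearZ -scalemxAl mxE. Qed.

Lemma dotvDr x y z : dotv z (x + y) = dotv z x + dotv z y.
Proof. by rewrite !(dotvC z) dotvDl. Qed.

Lemma dotvBr x y z : dotv z (x - y) = dotv z x - dotv z y.
Proof. by rewrite !(dotvC z) dotvBl. Qed.

Lemma dotvZr (k : R) x z : dotv z (k *: x) = k * dotv z x.
Proof. by rewrite !(dotvC z) dotvZl. Qed.

Lemma dotv_mulmxl A x y : dotv (A *m x) y = dotv x (A^T *m y).
Proof. by rewrite /dotv trmx_mul mulmxA. Qed.

Lemma dotv_ge0 x : 0 <= dotv x x.
Proof. by rewrite dotvE sumr_ge0 // => i _; rewrite -expr2 sqr_ge0. Qed.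

Lemma dotv_eq0 x : dotv x x = 0 -> x = 0.
Proof.
rewrite dotvE => /eqP; rewrite psumr_eq0; last by move=> i _; rewrite -expr2 sqr_ge0.
move=> /allP h; apply/colP => i; rewrite mxE.
by have := h i (mem_index_enum _); rewrite mulf_eq0 orbb => /eqP.
Qed.

Lemma enorm_ge0 x : 0 <= enorm x.
Proof. exact: sqrtr_ge0. Qed.

Lemma enorm_sqr x : enorm x ^+ 2 = dotv x x.
Proof. by rewrite sqr_sqrtr // dotv_ge0. Qed.

Lemma dotv_le_enorm x y : dotv x y <= enorm x * enorm y.
Proof.
have [->|y0] := eqVneq y 0.
  by rewrite dotvC /dotv trmx0 mul0mx mxE mulr_ge0 ?enorm_ge0.
have yy : 0 < dotv y y.
  by rewrite lt_def dotv_ge0 andbT; apply: contra y0 => /eqP/dotv_eq0 ->.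
rewrite (le_trans (ler_norm _))//.
rewrite -(@ler_pXn2r _ 2%N) ?nnegrE ?mulr_ge0 ?enorm_ge0 //.
rewrite exprMn !enorm_sqr real_normK ?num_real //.
(* This square equals [dotv y y] times the Cauchy-Schwarz defect, without any division. *)
have := dotv_ge0 (dotv y y *: x - dotv x y *: y).
rewrite !(dotvBl, dotvBr, dotvZl, dotvZr) (dotvC y x) => h.
rewrite -subr_ge0 -(pmulr_rge0 _ yy); apply: le_trans h _.
by rewrite le_eqVlt; apply/orP; left; apply/eqP; ring.
Qed.

Lemma enormD x y : enorm (x + y) <= enorm x + enorm y.
Proof.
rewrite -(@ler_pXn2r _ 2%N) ?nnegrE ?addr_ge0 ?enorm_ge0 //.
rewrite sqrrD !enorm_sqr !(dotvDl, dotvDr) (dotvC y x).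
have := dotv_le_enorm x y; lra.
Qed.

Lemma enormN x : enorm (- x) = enorm x.
Proof. by rewrite /enorm dotvNl dotvC dotvNl opprK. Qed.

Lemma enorm_le x y : (enorm x <= enorm y) = (dotv x x <= dotv y y).
Proof. by rewrite -!enorm_sqr ler_pXn2r // nnegrE enorm_ge0. Qed.

End DotProduct.

(** * Comparison of the maximum norm [|x|] with the Euclidean norm *)

Section Norms.
Context {R : realType}.

Lemma coord_le_norm m n (A : 'M[R]_(m, n)) i j : `|A i j| <= `|A|.
Proof.
rewrite [leRHS]/Num.Def.normr /= mx_normrE.
by apply: (@le_bigmax _ _ _ 0 (fun ij => `|A ij.1 ij.2|) (i, j)).
Qed.

Lemma norm_le_coord m n (A : 'M[R]_(m, n)) e :
  0 <= e -> (forall i j, `|A i j| <= e) -> `|A| <= e.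
Proof.
move=> e0 h; rewrite [leLHS]/Num.Def.normr /= mx_normrE.
by apply: bigmax_le => // ij _; exact: h.
Qed.

Lemma mulmx_norm m n p (A : 'M[R]_(m, n)) (B : 'M[R]_(n, p)) :
  `|A *m B| <= n%:R * `|A| * `|B|.
Proof.
apply: norm_le_coord => [|i j]; first by rewrite !mulr_ge0.
rewrite mxE; apply: le_trans (ler_norm_sum _ _ _) _.
apply: (@le_trans _ _ (\sum_(k < n) `|A| * `|B|)).
  by apply: ler_sum => k _; rewrite normrM ler_pM // coord_le_norm.
by rewrite sumr_const card_ord -[leLHS]mulr_natl mulrA.
Qed.

Lemma norm_le_enorm s (x : 'cV[R]_s) : `|x| <= enorm x.
Proof.
apply: norm_le_coord => [|i j]; first exact: enorm_ge0.
rewrite ord1 -(@ler_pXn2r _ 2%N) ?nnegrE ?enorm_ge0 // enorm_sqr.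
rewrite real_normK ?num_real // dotvE (bigD1 i) //= -expr2 lerDl.
by apply: sumr_ge0 => k _; rewrite -expr2 sqr_ge0.
Qed.

Lemma enorm_le_norm s (x : 'cV[R]_s) : enorm x <= s%:R * `|x|.
Proof.
rewrite -(@ler_pXn2r _ 2%N) ?nnegrE ?enorm_ge0 ?mulr_ge0 // enorm_sqr dotvE.
apply: (@le_trans _ _ (\sum_(i < s) `|x| ^+ 2)).
  apply: ler_sum => i _; rewrite -expr2 -[X in X <= _]real_normK ?num_real //.
  by rewrite ler_pXn2r ?nnegrE // coord_le_norm.
rewrite sumr_const card_ord -[leLHS]mulr_natl exprMn ler_wpM2r ?exprn_ge0 //.
by rewrite -natrX ler_nat; case: (s) => // k; rewrite leq_pmulr.
Qed.

Lemma dotv_le_norm s (x y : 'cV[R]_s) : `|dotv x y| <= s%:R * `|x| * `|y|.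
Proof.
apply: le_trans (coord_le_norm (x^T *m y) 0 0) (le_trans (mulmx_norm _ _) _).
rewrite !ler_wpM2r // ler_wpM2l //.
by apply: norm_le_coord => // i j; rewrite mxE coord_le_norm.
Qed.

End Norms.

Section Projectors.
Context {R : realType} {s : nat}.
Implicit Types (P Q A S V : 'M[R]_s).

Lemma mulmx_trmx_eq0 m n (A : 'M[R]_(m, n)) : A *m A^T = 0 -> A = 0.
Proof.
move=> h; apply/matrixP => i j; rewrite mxE.
have /eqP := congr1 (fun B : 'M[R]_m => B i i) h; rewrite !mxE psumr_eq0.
  move=> /allP /(_ j (mem_index_enum _)); rewrite mxE mulf_eq0 orbb.
  by move/eqP.
by move=> k _; rewrite mxE -expr2 sqr_ge0.
Qed.

Lemma inj_unitmx A : (forall x : 'cV[R]_s, A *m x = 0 -> x = 0) -> A \in unitmx.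
Proof.
move=> inj; rewrite -unitmx_tr -row_free_unit -kermx_eq0.
apply/eqP/row_matrixP => i; rewrite row0.
have : row i (kermx A^T) *m A^T = 0 by rewrite -row_mul mulmx_ker row0.
move/(congr1 trmx); rewrite trmx_mul trmxK trmx0 => /inj /(congr1 trmx).
by rewrite trmxK trmx0.
Qed.

(** In a rank factorization [P = C R], idempotence reads [C (R C) R = C R]; cancelling the full-rank
    factors gives [R C = 1], whose trace is the rank. *)
Lemma mxtrace_idem P : P *m P = P -> \tr P = (\rank P)%:R.
Proof.
move=> PP; rewrite -{1}(mulmx_base P) mxtrace_mulC.
suff -> : row_base P *m col_base P = 1%:M by rewrite mxtrace1.
apply: (row_full_inj (col_base_full P)).
apply: (row_free_inj (row_base_free P)).
by rewrite mulmx1 mulmxA mulmx_base -mulmxA mulmx_base PP.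
Qed.

(** The columns of [E] form an orthonormal basis of the range. Induction on the trace: removing a
    unit vector [u] of the range leaves the projector [Q - u u^T], whose trace is one less. *)
Lemma projector_factor r Q : Q^T = Q -> Q *m Q = Q -> \tr Q = r%:R ->
  exists E : 'M[R]_(s, r), E^T *m E = 1%:M /\ E *m E^T = Q.
Proof.
elim: r Q => [|r IH] Q Qt QQ trQ.
  have Q0 : Q = 0.
    apply: mulmx_trmx_eq0; apply/matrixP => i j; rewrite Qt QQ [RHS]mxE.
    have : \tr (Q *m Q^T) = 0 by rewrite Qt QQ trQ.
    rewrite /mxtrace => /eqP; rewrite psumr_eq0; last first.
      by move=> k _; rewrite mxE sumr_ge0 // => l _; rewrite mxE -expr2 sqr_ge0.
    move=> /allP /(_ i (mem_index_enum _)) /=; rewrite mxE psumr_eq0.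
      move=> /allP /(_ j (mem_index_enum _)) /=; rewrite mxE mulf_eq0 orbb.
      by move/eqP.
    by move=> k _; rewrite mxE -expr2 sqr_ge0.
  exists 0; split; last by rewrite mul0mx Q0.
  by apply/matrixP => -[].
have [v v0 Qv] : exists2 v : 'cV[R]_s, v != 0 & Q *m v = v.
  have : Q != 0.
    apply/eqP => Q0; move: trQ; rewrite Q0 mxtrace0 => /esym/eqP.
    by rewrite pnatr_eq0.
  case: (pselect (exists j, col j Q != 0)) => [[j cj] _|h /eqP[]].
    by exists (col j Q) => //; rewrite colE mulmxA QQ.
  apply/matrixP => i j; rewrite mxE.
  have /eqP/colP/(_ i) : col j Q == 0.
    by apply/negPn/negP => cj; apply: h; exists j.
  by rewrite !mxE.
have e0 : enorm v != 0.
  by apply: contra v0 => /eqP e0; rewrite (dotv_eq0 (x := v)) // -enorm_sqr e0 expr0n.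
pose u := (enorm v)^-1 *: v.
have Qu : Q *m u = u by rewrite -scalemxAr Qv.
have uu : u^T *m u = 1%:M.
  apply/matrixP => i j; rewrite !ord1 [RHS]mxE -/(dotv u u).
  by rewrite dotvZl dotvZr -enorm_sqr eqxx mulr1n; field.
have uQ : u^T *m Q = u^T by rewrite -[in RHS]Qu trmx_mul Qt.
pose Q' := Q - u *m u^T.
have uuu : u *m u^T *m (u *m u^T) = u *m u^T.
  by rewrite mulmxA -(mulmxA u) uu mulmx1.
have Q'u : Q' *m u = 0 by rewrite mulmxBl Qu -mulmxA uu mulmx1 subrr.
have [||| E [EE EEt]] := IH Q'.
- by rewrite linearB /= Qt trmx_mul trmxK.
- by rewrite mulmxBl !mulmxBr QQ uuu -(mulmxA u) uQ (mulmxA Q) Qu subrr subr0.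
- by rewrite linearB /= trQ mxtrace_mulC uu mxtrace1 -natr1 addrK.
(* The squared length of [E^T u] is [u^T Q' u = 0]. *)
have Eu : E^T *m u = 0.
  suff /(congr1 trmx) : (E^T *m u)^T = 0 by rewrite trmxK trmx0.
  apply: mulmx_trmx_eq0; rewrite trmxK trmx_mul trmxK.
  by rewrite mulmxA -(mulmxA u^T) EEt -mulmxA Q'u mulmx0.
have FFt : row_mx u E *m (row_mx u E)^T = Q.
  by rewrite tr_row_mx mul_row_col EEt addrC subrK.
have FF : (row_mx u E)^T *m row_mx u E = 1%:M.
  rewrite tr_row_mx mul_col_row uu EE Eu.
  have -> : u^T *m E = 0 by rewrite -[LHS]trmxK trmx_mul trmxK Eu trmx0.
  by rewrite -scalar_mx_block.
by exists (row_mx u E).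
Qed.

(* Complete [A], an isometry from the range of [A^T A] onto the range of [P], by an isometry between the orthogonal complements, which have the same dimension. *)
Lemma partial_isometry_extend P A : P^T = P -> P *m P = P -> A *m A^T = P ->
  exists H : 'M[R]_s, H^T *m H = 1%:M /\ A = P *m H.
Proof.
move=> Pt PP AAt.
have PA : (1%:M - P) *m A = 0.
  apply: mulmx_trmx_eq0; rewrite trmx_mul linearB /= trmx1 Pt mulmxA.
  by rewrite -(mulmxA _ A) AAt mulmxBl mul1mx PP subrr mul0mx.
have {}PA' : P *m A = A.
  by move: PA; rewrite mulmxBl mul1mx => /eqP; rewrite subr_eq0 => /eqP.
pose Q := A^T *m A.
have Qt : Q^T = Q by rewrite trmx_mul trmxK.
have QQ : Q *m Q = Q by rewrite /Q mulmxA -(mulmxA A^T) AAt -mulmxA PA'.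
have idC (B : 'M[R]_s) : B *m B = B -> (1%:M - B) *m (1%:M - B) = 1%:M - B.
  by move=> BB; rewrite mulmxBl !mulmxBr !mul1mx mulmx1 BB subrr subr0.
have trC (B : 'M[R]_s) : B^T = B -> (1%:M - B)^T = 1%:M - B.
  by move=> BB; rewrite linearB /= trmx1 BB.
have trPC := mxtrace_idem (idC _ PP).
(* [A^T A] and [A A^T] have the same trace, so both complements factor through the same number of
   columns. *)
have trQC : \tr (1%:M - Q) = (\rank (1%:M - P))%:R.
  by rewrite -trPC !linearB /= [\tr Q]mxtrace_mulC AAt.
have [E [EE EP]] := projector_factor (trC _ Pt) (idC _ PP) trPC.
have [F [FF FQ]] := projector_factor (trC _ Qt) (idC _ QQ) trQC.
have EA : E^T *m A = 0.
  by rewrite -[E^T]mul1mx -EE -(mulmxA E^T) EP -mulmxA PA mulmx0.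
have PE : P *m E = 0.
  rewrite -[E]mulmx1 -EE (mulmxA E) EP mulmxA.
  by rewrite mulmxBr mulmx1 PP subrr mul0mx.
exists (A + E *m F^T); split; last by rewrite mulmxDr PA' mulmxA PE mul0mx addr0.
rewrite [(A + _)^T]linearD /= trmx_mul trmxK mulmxDl !mulmxDr -/Q.
have -> : A^T *m (E *m F^T) = 0.
  by rewrite mulmxA -[A^T *m E]trmxK trmx_mul trmxK EA trmx0 mul0mx.
rewrite -(mulmxA F) EA mulmx0 (mulmxA _ E) -(mulmxA F) EE mulmx1 FQ.
by rewrite addr0 add0r addrC subrK.
Qed.

(** Pad the orthonormal basis [E] of the range with zero columns. The square matrix obtained,
    [K = E *m pid_mx m], has [K K^T = P] and [K^T K = pid_mx m]; extending it to an orthogonal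
    matrix conjugates one into the other. *)
Lemma projector_diag P m : P^T = P -> P *m P = P -> \rank P = m -> (m <= s)%N ->
  exists H : 'M[R]_s, H^T *m H = 1%:M /\ P = H^T *m pid_mx m *m H.
Proof.
move=> Pt PP rP ms.
have [E [EE EP]] := projector_factor Pt PP (mxtrace_idem PP).
rewrite rP in E EE EP *.
have [|H [HH KH]] := @partial_isometry_extend P (E *m pid_mx m) Pt PP.
  by rewrite trmx_mul tr_pid_mx mulmxA -(mulmxA E) pid_mx_id // pid_mx_1 mulmx1.
have HH' : H *m H^T = 1%:M by apply: mulmx1C.
exists H^T; rewrite trmxK; split=> //.
have -> : pid_mx m = H^T *m P *m H :> 'M[R]_s.
  have -> : H^T *m P *m H = (P *m H)^T *m (P *m H).
    by rewrite trmx_mul Pt mulmxA -(mulmxA _ P P) PP.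
  rewrite -KH trmx_mul tr_pid_mx mulmxA -(mulmxA (pid_mx m)) EE mulmx1.
  by rewrite pid_mx_id.
by rewrite !mulmxA HH' mul1mx -mulmxA HH' mulmx1.
Qed.

Lemma spd_unitmx S : spd S -> S \in unitmx.
Proof.
case=> _ pos; apply: inj_unitmx => x Sx; apply/eqP; apply: contraT => x0.
by have := pos x x0; rewrite Sx /dotv mulmx0 mxE ltxx.
Qed.

Lemma sqrtm_projector P V V12 S : P^T = P -> P *m P = P -> is_sqrtm V V12 ->
  is_sqrtm (1%:M - P + P *m V *m P) S ->
  let A := invmx S *m P *m V12 in A *m A^T = P.
Proof.
move=> Pt PP [[V12t _] V12V] [[St Spos] SS] A.
have Su : S \in unitmx by apply: spd_unitmx.
have PC : P *m (1%:M - P) = 0 by rewrite mulmxBr mulmx1 PP subrr.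
have CC : (1%:M - P) *m (1%:M - P) = 1%:M - P.
  by rewrite mulmxBl mul1mx PC subr0.
have S1u : S + 1%:M \in unitmx.
  apply: spd_unitmx; split; first by rewrite linearD /= St trmx1.
  move=> x x0; rewrite mulmxDl mul1mx dotvDr ltr_pwDl ?Spos //.
  exact: dotv_ge0.
(* [S + 1] is invertible and [(S + 1)(S - 1)(1 - P) = (S S - 1)(1 - P) = 0], so the root fixes
   normal vectors. *)
have SC : S *m (1%:M - P) = 1%:M - P.
  apply/eqP; rewrite -subr_eq0 -{2}[1%:M - P]mul1mx -mulmxBl.
  rewrite -[X in X == _](mulKmx S1u) (mulmxA (S + _)).
  have -> : (S + 1%:M) *m (S - 1%:M) = S *m S - 1%:M.
    by rewrite mulmxDl !mulmxBr mul1mx !mulmx1 addrA subrK.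
  rewrite SS mulmxBl mulmxDl CC -(mulmxA _ P) PC mulmx0 addr0 mul1mx subrr.
  by rewrite mulmx0.
have SiC : invmx S *m (1%:M - P) = 1%:M - P by rewrite -{1}SC mulKmx.
have Sit : (invmx S)^T = invmx S by rewrite trmx_inv St.
have -> : A *m A^T = invmx S *m (P *m V *m P) *m invmx S.
  rewrite /A !trmx_mul V12t Pt Sit !mulmxA -(mulmxA _ V12 V12) V12V.
  by [].
have -> : P *m V *m P = S *m S - (1%:M - P) by rewrite SS [X in X - _]addrC addrK.
rewrite mulmxBr mulmxBl mulKmx // mulmxV // SiC.
have -> : (1%:M - P) *m invmx S = 1%:M - P.
  by rewrite -[LHS]trmxK trmx_mul Sit linearB /= trmx1 Pt SiC linearB /= trmx1 Pt.
by rewrite subKr.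
Qed.

End Projectors.

(** * Differential calculus of smooth maps *)

Section Differentiation.
Context {R : realType}.

Lemma cvg_eps_delta (V W : normedModType R) (f : V -> W) (p : V) :
  {for p, continuous f} ->
  forall e : R, 0 < e -> exists2 d : R, 0 < d &
    forall x, `|x - p| <= d -> `|f x - f p| <= e.
Proof.
move=> fc e e0; move/cvgrPdist_le : fc => /(_ e e0) /nbhs_ballP [d /= d0 h].
exists (d / 2); first by rewrite divr_gt0.
move=> x xp; rewrite distrC; apply: h; rewrite -ball_normE /= distrC.
by apply: le_lt_trans xp _; rewrite ltr_pdivrMr // ltr_pMr // ltr1n.
Qed.

(** Multiplying the difference quotient by [|h|] removes the division and the restriction [h != 0];
    together with the converse below, this turns later differentiations into estimates. *)
Lemma is_derive_eps (V W : normedModType R) (f : V -> W) (x v : V) (w : W) :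
  (forall e : R, 0 < e -> exists2 d : R, 0 < d &
    forall h : R, `|h| <= d -> `|f (x + h *: v) - f x - h *: w| <= e * `|h|) ->
  is_derive x v f w.
Proof.
move=> H.
have C : h^-1 *: ((f \o shift x) (h *: v) - f x) @[h --> 0^'] --> w.
  apply/cvgrPdist_le => e e0; have [d d0 Hd] := H e e0.
  near=> h.
  have h0 : h != 0 by near: h; exact: nbhs_dnbhs_neq.
  have -> : w - h^-1 *: ((f \o shift x) (h *: v) - f x)
          = - (h^-1 *: (f (x + h *: v) - f x - h *: w)).
    by rewrite [in RHS]scalerBr scalerA mulVf // scale1r opprB /= [x + _]addrC.
  rewrite normrN normrZ normfV mulrC ler_pdivrMr ?normr_gt0 //.
  by apply: Hd; near: h; exact: dnbhs0_le.
by apply: DeriveDef; [apply/cvg_ex; exists w | exact: cvg_lim].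
Unshelve. all: by end_near. Qed.

Lemma is_derive_eps_delta (V W : normedModType R) (f : V -> W) (x v : V) (w : W) :
  is_derive x v f w ->
  forall e : R, 0 < e -> exists2 d : R, 0 < d &
    forall h : R, `|h| <= d -> `|f (x + h *: v) - f x - h *: w| <= e * `|h|.
Proof.
move=> [df <-] e e0; move/cvgrPdist_le : df => /(_ e e0).
move=> /nbhs_ballP [d /= d0 H].
exists (d / 2); first by rewrite divr_gt0.
move=> h hd; have [->|h0] := eqVneq h 0.
  by rewrite !scale0r addr0 subrr subr0 !normr0 mulr0.
have := H h; rewrite -ball_normE /= sub0r normrN => /(_ _ h0).
have hd' : `|h| < d.
  by apply: le_lt_trans hd _; rewrite ltr_pdivrMr // ltr_pMr // ltr1n.
move=> /(_ hd') {}H.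
have -> : f (x + h *: v) - f x - h *: 'D_v f x
  = - (h *: ('D_v f x - h^-1 *: (f (h *: v + x) - f x))).
  by rewrite scalerBr scalerA divff // scale1r opprB [x + _]addrC.
by rewrite normrN normrZ mulrC ler_wpM2r.
Qed.

Lemma derive_line (V W : normedModType R) (f : V -> W) (x v : V) (r : R) :
  derivable f (x + r *: v) v ->
  is_derive r 1 (fun a : R => f (x + a *: v)) ('D_v f (x + r *: v)).
Proof.
move=> df; apply: is_derive_eps => e e0.
have [d d0 H] := is_derive_eps_delta (derivableP df) e0.
by exists d => // h hd; rewrite scaler1 scalerDl addrA; exact: H.
Qed.

Lemma line_mean_value (V : normedModType R) (f : V -> R) (x v : V) (h : R) :
  (forall y, derivable f y v) ->
  exists2 a : R, 0 <= a <= 1 & f (x + h *: v) - f x = h * 'D_v f (x + (a * h) *: v).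
Proof.
move=> df.
wlog h0 : x h / 0 <= h => [H|].
  have [/H//|h0] := leP 0 h.
  (* For negative [h] the segment is run from its other end, which replaces [a] by [1 - a]. *)
  have [|a /andP[a0 a1] E] := H (x + h *: v) (- h); first by rewrite oppr_ge0 ltW.
  exists (1 - a); first by rewrite subr_ge0 a1 lerBlDr lerDl.
  move: E; rewrite -!addrA -!scalerDl subrr scale0r addr0 => /(congr1 -%R).
  rewrite opprB mulNr opprK => ->.
  by have -> : h + a * - h = (1 - a) * h by ring.
have [|c] := @MVT_segment _ (fun a : R => f (x + a *: v))
    (fun a => 'D_v f (x + a *: v)) 0 h h0 (fun a _ => derive_line (df _)).
  apply: continuous_subspaceT => a.
  apply: differentiable_continuous; apply/derivable1_diffP.
  by have [] := derive_line (df (x + a *: v)).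
rewrite in_itv /= => /andP[c0 ch]; rewrite scale0r addr0 subr0 mulrC => E.
have [h0'|h0'] := eqVneq h 0.
  by exists 0; rewrite ?lexx ?ler01 //; rewrite h0' scale0r addr0 subrr mul0r.
have hp : 0 < h by rewrite lt_def h0' h0.
exists (c / h); first by rewrite divr_ge0 // ler_pdivrMr // mul1r.
by rewrite divfK.
Qed.

Definition C1 {V W : normedModType R} (f : V -> W) : Prop :=
  (forall v x, derivable f x v) /\ (forall v, continuous ('D_v f)).

Lemma smooth_C1 (V W : normedModType R) (f : V -> W) : smooth f -> C1 f.
Proof.
by move=> sf; split=> [|v]; [have [] := sf [::] | have [] := sf [:: v]].
Qed.

(** The head of the list is the outermost derivative, so differentiating [f] beforehand appends at
    the end. *)
Lemma iter_deriv_rcons (V W : normedModType R) (f : V -> W) vs v :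
  iter_deriv f (rcons vs v) = iter_deriv ('D_v f) vs.
Proof. by elim: vs => //= w vs ->. Qed.

Lemma smooth_derive (V W : normedModType R) (f : V -> W) v :
  smooth f -> smooth ('D_v f).
Proof. by move=> sf vs; have := sf (rcons vs v); rewrite iter_deriv_rcons. Qed.

Lemma continuous_coord (V : normedModType R) m n (f : V -> 'M[R]_(m, n)) i j x :
  {for x, continuous f} -> {for x, continuous (fun y => f y i j)}.
Proof.
move/cvgrPdist_le => H; apply/cvgrPdist_le => e e0; move: (H e e0).
apply: filterS => y; apply: le_trans.
by have := coord_le_norm (f x - f y) i j; rewrite !mxE.
Qed.

Lemma derive_coord (V : normedModType R) m n (f : V -> 'M[R]_(m, n)) x v i j :
  derivable f x v -> 'D_v f x i j = 'D_v (fun y => f y i j) x.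
Proof. by move=> df; rewrite derive_mx // mxE. Qed.

Lemma C1_coord (V : normedModType R) m n (f : V -> 'M[R]_(m, n)) i j :
  C1 f -> C1 (fun x => f x i j).
Proof.
move=> [df cf]; split=> [v x|v]; first by have /derivable_mxP := df v x.
have -> : 'D_v (fun x => f x i j) = (fun x => 'D_v f x i j).
  by apply/funext => x; rewrite derive_mx // mxE.
by move=> x; exact: (@continuous_coord _ _ _ ('D_v f) i j x (cf v x)).
Qed.

Lemma smooth_coord (V : normedModType R) m n (f : V -> 'M[R]_(m, n)) i j :
  smooth f -> smooth (fun x => f x i j).
Proof.
move=> sf vs.
have -> : iter_deriv (fun x => f x i j) vs = (fun x => iter_deriv f vs x i j).
  elim: vs => //= v vs ->; apply/funext => x.
  by rewrite derive_mx ?mxE //; have [+ _] := sf vs; apply.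
have [df cf] := sf vs; split=> [v x|x]; first by have /derivable_mxP := df v x.
exact: (@continuous_coord _ _ _ (iter_deriv f vs) i j x (cf x)).
Qed.

(** A coordinate of a derivative is the derivative of the coordinate only once derivability is
    known, so both facts go through one induction on the list of directions. *)
Lemma smooth_coords (V : normedModType R) m n (f : V -> 'M[R]_(m, n)) :
  (forall i j, smooth (fun x => f x i j)) -> smooth f.
Proof.
move=> sf.
have E : forall vs, (forall x v, derivable (iter_deriv f vs) x v) /\
   forall i j, iter_deriv (fun x => f x i j) vs = (fun x => iter_deriv f vs x i j).
  elim=> [|v vs [IHd IHe]] /=.
    by split=> // x v; apply/derivable_mxP => i j; have [] := sf i j [::].
  have Ee i j : 'D_v (iter_deriv (fun x => f x i j) vs) =
                (fun x => 'D_v (iter_deriv f vs) x i j).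
    by apply/funext => x; rewrite IHe derive_mx // mxE.
  split; last exact: Ee.
  move=> x w; apply: (derivable_mxP ('D_v (iter_deriv f vs)) x w).2 => i j.
  by have := (sf i j (v :: vs)).1 w x; rewrite /= Ee.
move=> vs; have [Ed Ee] := E vs; split=> [v x|x]; first exact: Ed.
apply/cvgrPdist_le => e e0.
near=> y; apply: norm_le_coord; first exact: ltW.
near: y; apply: filter_forall => i; apply: filter_forall => j.
have [_ /(_ x)] := sf i j vs; rewrite Ee => /cvgrPdist_le /(_ e e0).
by apply: filterS => y; rewrite !mxE.
Unshelve. all: by end_near. Qed.

End Differentiation.

(** * Strict differentiability, chain rule and symmetry of second derivatives *)

Section Jacobian.
Context {R : realType} {s : nat}.

Definition Jac {k : nat} (f : 'cV[R]_s -> 'cV[R]_k) (p : 'cV[R]_s) : 'M[R]_(k, s) :=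
  \matrix_(i, j) 'D_(delta_mx j 0) f p i 0.

Lemma exists_delta_forall (I : finType) (Q : I -> R -> Prop) :
  (forall i d d', 0 < d' -> d' <= d -> Q i d -> Q i d') ->
  (forall i, exists2 d : R, 0 < d & Q i d) ->
  exists2 d : R, 0 < d & forall i, Q i d.
Proof.
move=> mono H.
pose d0 i := s2val (cid2 (H i)).
exists (\big[Num.min/1]_i d0 i).
  apply: lt_bigmin => // i _; rewrite /d0; exact: (s2valP (cid2 (H i))).
move=> i; apply: (mono _ (d0 i)); last exact: (s2valP' (cid2 (H i))).
- apply: lt_bigmin => // j _; rewrite /d0; exact: (s2valP (cid2 (H j))).
- exact: bigmin_le_cond.
Qed.

(* Move from [y] to [x] one coordinate at a time, applying the mean value theorem to each step. *)
Lemma strict_derive_scalar (f : 'cV[R]_s -> R) (p : 'cV[R]_s) : C1 f ->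
  forall e : R, 0 < e -> exists2 d : R, 0 < d &
    forall x y, `|x - p| <= d -> `|y - p| <= d ->
    `|f x - f y - \sum_j (x j 0 - y j 0) * 'D_(delta_mx j 0) f p| <= e * `|x - y|.
Proof.
move=> [df cf] e e0.
have s0 : 0 < (s%:R + 1 : R) by rewrite ltr_wpDl.
have [j d d' d'0 dd' H x xd|j|d d0 Hd] := @exists_delta_forall 'I_s (fun j d =>
  forall x, `|x - p| <= d ->
   `|'D_(delta_mx j 0) f x - 'D_(delta_mx j 0) f p| <= e / (s%:R + 1)).
- by apply: H; exact: le_trans xd dd'.
- by apply: cvg_eps_delta; [exact: cf | exact: divr_gt0].
exists d => // x y xd yd.
(* [z k] has its first [k] coordinates from [x] and the others from [y]; it leads from [y] at
   [k = 0] to [x] at [k = s]. *)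
pose z k : 'cV[R]_s := \col_j if (j < k)%N then x j 0 else y j 0.
have -> : f x - f y = \sum_(0 <= k < s) (f (z k.+1) - f (z k)).
  rewrite telescope_sumr //; congr (f _ - f _); apply/colP => j; rewrite mxE //.
  by rewrite ltn_ord.
rewrite big_mkord -sumrB.
apply: le_trans (ler_norm_sum _ _ _) _.
apply: (@le_trans _ _ (\sum_(k < s) e / (s%:R + 1) * `|x - y|)); last first.
  rewrite sumr_const card_ord -[leLHS]mulr_natl mulrA ler_wpM2r //.
  by rewrite mulrA ler_pdivrMr // mulrDr mulr1 mulrC lerDl ltW.
apply: ler_sum => j _.
pose h := x j 0 - y j 0.
have -> : z j.+1 = z j + h *: delta_mx j 0.
  apply/colP => i; rewrite !mxE eqxx andbT /h ltnS.
  have [->|ij] := eqVneq i j; first by rewrite leqnn ltnn mulr1 addrC subrK.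
  by rewrite mulr0 addr0 leq_eqVlt (negbTE ij : (i == j :> nat) = false).
have [a /andP[a0 a1] ->] := line_mean_value (z j) h (df (delta_mx j 0)).
rewrite -/h -mulrBr normrM mulrC; apply: ler_pM => //; last first.
  by rewrite /h; have := coord_le_norm (x - y) j 0; rewrite !mxE.
apply: Hd; apply: norm_le_coord => [|i k]; first exact: ltW.
have xi : `|x i 0 - p i 0| <= d.
  by apply: le_trans xd; have := coord_le_norm (x - p) i 0; rewrite !mxE.
have yi : `|y i 0 - p i 0| <= d.
  by apply: le_trans yd; have := coord_le_norm (y - p) i 0; rewrite !mxE.
rewrite ord1 !mxE eqxx andbT.
have [ij|ij] := eqVneq i j; last by rewrite mulr0 addr0; case: ifP.
rewrite ij in xi yi *; rewrite ltnn mulr1 /h.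
have -> : y j 0 + a * (x j 0 - y j 0) - p j 0 =
          (1 - a) * (y j 0 - p j 0) + a * (x j 0 - p j 0) by ring.
move: xi yi; rewrite !ler_norml => /andP[x1 x2] /andP[y1 y2].
apply/andP; split; nra.
Qed.

Lemma derive_scalarE (f : 'cV[R]_s -> R) p v : C1 f ->
  'D_v f p = \sum_j v j 0 * 'D_(delta_mx j 0) f p.
Proof.
move=> cf; apply: (@derive_val _ _ _ _ _ _ _ (is_derive_eps _)) => e e0.
have v0 : 0 < `|v| + 1 by rewrite ltr_wpDl.
have [d d0 Hd] := strict_derive_scalar p cf (divr_gt0 e0 v0).
exists (d / (`|v| + 1)); first by rewrite divr_gt0.
move=> h hd.
have := Hd (p + h *: v) p; rewrite subrr normr0 [p + _ - p]addrC addKr => H.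
rewrite scaler_sumr; under eq_bigr do rewrite scalerAl.
under eq_bigr => j _.
  have -> : h *: v j 0 = (p + h *: v) j 0 - p j 0 by rewrite !mxE [RHS]addrAC subrr add0r.
  over.
have hv : `|h *: v| <= d.
  by rewrite normrZ -(divfK (lt0r_neq0 v0) d) ler_pM // lerDl.
apply: le_trans (H hv (ltW d0)) _.
rewrite normrZ [`|h| * _]mulrC mulrA ler_wpM2r // mulrAC ler_pdivrMr //.
by rewrite ler_wpM2l ?ltW// ltrDl.
Qed.

Section Vector.
Context {k : nat} (f : 'cV[R]_s -> 'cV[R]_k).
Hypothesis cf : C1 f.

Lemma Jac_coord p i j : Jac f p i j = 'D_(delta_mx j 0) (fun x => f x i 0) p.
Proof. by rewrite mxE derive_mx ?mxE //; apply: cf.1. Qed.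

Lemma derive_Jac p v : 'D_v f p = Jac f p *m v.
Proof.
apply/colP => i; rewrite derive_mx ?mxE; last exact: cf.1.
rewrite derive_scalarE; last exact: C1_coord.
by apply: eq_bigr => j _; rewrite Jac_coord mulrC.
Qed.

(** Both points are free near [p]. With one of them at [p] this is total differentiability; with
    both free it yields the contraction and the Lipschitz bounds of the implicit curve. *)
Lemma strict_derive p e : 0 < e -> exists2 d : R, 0 < d &
    forall x y, `|x - p| <= d -> `|y - p| <= d ->
    `|f x - f y - Jac f p *m (x - y)| <= e * `|x - y|.
Proof.
move=> e0.
have [i d d' d'0 dd' H x y xd yd|i|d d0 Hd] := @exists_delta_forall 'I_k (fun i d =>
  forall x y, `|x - p| <= d -> `|y - p| <= d ->
    `|f x i 0 - f y i 0 - \sum_j (x j 0 - y j 0) * 'D_(delta_mx j 0) (fun x => f x i 0) p|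
     <= e * `|x - y|).
- by apply: H; [exact: le_trans xd dd' | exact: le_trans yd dd'].
- by apply: strict_derive_scalar => //; exact: C1_coord.
exists d => // x y xd yd; apply: norm_le_coord => [|i j].
  by rewrite mulr_ge0 // ltW.
rewrite ord1 !mxE; apply: le_trans (Hd i x y xd yd).
rewrite le_eqVlt; apply/orP; left; apply/eqP; congr (`|_ - _|).
by apply: eq_bigr => l _; rewrite Jac_coord !mxE mulrC.
Qed.

Lemma Jac_continuous p e : 0 < e -> exists2 d : R, 0 < d &
    forall x, `|x - p| <= d -> `|Jac f x - Jac f p| <= e.
Proof.
move=> e0.
have [j d d' d'0 dd' H x xd|j|d d0 Hd] := @exists_delta_forall 'I_s (fun j d =>
  forall x, `|x - p| <= d ->
   `|'D_(delta_mx j 0) f x - 'D_(delta_mx j 0) f p| <= e).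
- by apply: H; exact: le_trans xd dd'.
- by apply: cvg_eps_delta => //; exact: cf.2.
exists d => // x xd; apply: norm_le_coord => [|i j]; first exact: ltW.
apply: le_trans (Hd j x xd).
have := coord_le_norm ('D_(delta_mx j 0) f x - 'D_(delta_mx j 0) f p) i 0.
by rewrite !mxE.
Qed.

Lemma is_derive_comp_curve (V : normedModType R) (g : V -> 'cV[R]_s) (x u : V) w :
  is_derive x u g w ->
  is_derive x u (fun y => f (g y)) (Jac f (g x) *m w).
Proof.
move=> dg; apply: is_derive_eps => e e0.
set J := Jac f (g x).
have c0 : 0 < s%:R * `|J| + 1 by rewrite ltr_wpDl // mulr_ge0.
have w0 : 0 < `|w| + 1 by rewrite ltr_wpDl.
(* The bound [1] makes [g] Lipschitz at [x] with constant [|w| + 1]; the other bound pays for [J]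
   applied to the error of [g]. *)
pose e1 := Num.min 1 (e / 2 / (s%:R * `|J| + 1)).
have e1p : 0 < e1 by rewrite /e1 lt_min ltr01 !divr_gt0.
have [d1 d10 H1] := is_derive_eps_delta dg e1p.
have e2p : 0 < e / 2 / (`|w| + 1) by rewrite !divr_gt0.
have [d2 d20 H2] := strict_derive (g x) e2p.
exists (Num.min d1 (d2 / (`|w| + 1))).
  by rewrite lt_min d10 divr_gt0.
move=> h; rewrite le_min => /andP[hd1 hd2].
have {}H1 := H1 h hd1.
have gl : `|g (x + h *: u) - g x| <= (`|w| + 1) * `|h|.
  rewrite -(subrK (h *: w) (g (x + h *: u) - g x)).
  apply: le_trans (ler_normD _ _) _; rewrite normrZ mulrDl addrC mulrC lerD //.
  by apply: le_trans H1 _; rewrite ler_wpM2r // /e1 ge_min lexx.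
have := H2 (g (x + h *: u)) (g x); rewrite subrr normr0 => /(_ _ (ltW d20)).
have gd : `|g (x + h *: u) - g x| <= d2.
  by apply: le_trans gl _; rewrite mulrC -ler_pdivlMr.
move=> /(_ gd) {}H2.
have -> : f (g (x + h *: u)) - f (g x) - h *: (J *m w) =
  (f (g (x + h *: u)) - f (g x) - J *m (g (x + h *: u) - g x)) +
  J *m (g (x + h *: u) - g x - h *: w).
  by rewrite [in X in _ = _ + X]mulmxBr -scalemxAr addrA subrK.
apply: le_trans (ler_normD _ _) _.
rewrite [e]splitr mulrDl lerD //.
  apply: le_trans H2 _; apply: le_trans (ler_wpM2l (ltW e2p) gl) _.
  by rewrite mulrA divfK ?lt0r_neq0.
apply: le_trans (mulmx_norm _ _) _.
apply: (@le_trans _ _ ((s%:R * `|J| + 1) * (e1 * `|h|))).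
  by apply: ler_pM; rewrite ?mulr_ge0 ?lerDl.
rewrite mulrA ler_wpM2r // mulrC -ler_pdivlMr //.
by rewrite /e1 ge_min lexx orbT.
Qed.

End Vector.

Lemma derive_translate (V W : normedModType R) (f : V -> W) c x u :
  derivable f (x + c) u ->
  is_derive x u (fun y => f (y + c)) ('D_u f (x + c)).
Proof.
move=> df; apply: is_derive_eps => e e0.
have [d d0 H] := is_derive_eps_delta (derivableP df) e0.
exists d => // h hd.
by have -> : x + h *: u + c = x + c + h *: u by [rewrite addrAC]; exact: H.
Qed.

Lemma ler_dist_half (a b c e : R) :
  `|a - b| <= e / 2 -> `|a - c| <= e / 2 -> `|b - c| <= e.
Proof. by rewrite !ler_norml => /andP[? ?] /andP[? ?]; apply/andP; split; lra. Qed.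

(* Both mixed derivatives are limits of the same second-order difference quotient. *)
Lemma derive_symmetric (V : normedModType R) (f : V -> R) (u v p : V) : smooth f ->
  'D_u ('D_v f) p = 'D_v ('D_u f) p.
Proof.
move=> sf.
have mixed u' v' (h : R) : exists a b : R, [/\ 0 <= a <= 1, 0 <= b <= 1 &
   f (p + h *: u' + h *: v') - f (p + h *: u') - (f (p + h *: v') - f p) =
   h * (h * 'D_v' ('D_u' f) (p + (a * h) *: u' + (b * h) *: v'))].
  pose g x := f (x + h *: v') - f x.
  have dg y : is_derive y u' g ('D_u' f (y + h *: v') - 'D_u' f y).
    apply: is_deriveB; last by apply: derivableP; have [] := sf [::].
    by apply: derive_translate; have [] := sf [::].
  have [a a01] := line_mean_value p h (fun y => @ex_derive _ _ _ _ _ _ _ (dg y)).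
  rewrite /g => E.
  have [b b01 E'] := line_mean_value (p + (a * h) *: u') h
     (fun y => (sf [:: u']).1 v' y).
  exists a, b; split=> //; rewrite [LHS]E; congr (_ * _).
  by rewrite (@derive_val _ _ _ _ _ _ _ (dg _)) -E'.
apply/eqP; rewrite -subr_eq0 -normr_le0; apply/ler_addgt0Pl => e e0; rewrite addr0.
have e2 : 0 < e / 2 by rewrite divr_gt0.
have [d1 d10 H1] := cvg_eps_delta ((sf [:: u; v]).2 p) e2.
have [d2 d20 H2] := cvg_eps_delta ((sf [:: v; u]).2 p) e2.
have n0 : 0 < `|u| + `|v| + 1 by rewrite ltr_wpDl // addr_ge0.
pose h : R := Num.min d1 d2 / (`|u| + `|v| + 1).
have h0 : 0 < h by rewrite divr_gt0 // lt_min d10.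
have small u' v' (a b : R) : `|u'| + `|v'| = `|u| + `|v| -> 0 <= a <= 1 -> 0 <= b <= 1 ->
  `|p + (a * h) *: u' + (b * h) *: v' - p| <= Num.min d1 d2.
  move=> E /andP[a0 a1] /andP[b0 b1]; rewrite -[p + _ + _]addrA [X in `|X|]addrC addKr.
  have sc (c : R) (w : V) : 0 <= c -> c <= 1 -> `|(c * h) *: w| <= h * `|w|.
    move=> c0 c1; rewrite normrZ ger0_norm; last by rewrite mulr_ge0 // ltW.
    by rewrite ler_wpM2r // ler_piMl // ltW.
  apply: le_trans (ler_normD _ _) (le_trans (lerD (sc a _ a0 a1) (sc b _ b0 b1)) _).
  rewrite -mulrDr E /h mulrAC ler_pdivrMr // ler_wpM2l ?lerDl //.
  by rewrite le_min !ltW.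
have [a [b [a01 b01 E1]]] := mixed v u h.
have [a' [b' [a01' b01' E2]]] := mixed u v h.
(* Both sides times [h * h] equal the same second difference of [f], up to the order of its middle
   terms. *)
have E : 'D_u ('D_v f) (p + (a * h) *: v + (b * h) *: u) =
         'D_v ('D_u f) (p + (a' * h) *: u + (b' * h) *: v).
  have hn := lt0r_neq0 h0.
  have cancel (A B c : R) : c = h * (h * A) -> c = h * (h * B) -> A = B.
    by move=> -> /(mulfI hn)/(mulfI hn).
  apply: (cancel _ _ _ E1); apply: etrans _ E2.
  by rewrite (addrAC p (h *: v)); ring.
have := H1 (p + (a * h) *: v + (b * h) *: u).
have /(_ (addrC _ _) a01 b01) := small v u a b.
rewrite le_min => /andP[S1 _] /(_ S1) /= {}H1.
have := H2 (p + (a' * h) *: u + (b' * h) *: v).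
have /(_ erefl a01' b01') := small u v a' b'.
rewrite le_min => /andP[_ S2] /(_ S2) /= {}H2.
move: H1; rewrite E => H1.
exact: ler_dist_half H1 H2.
Qed.

Lemma is_derive_dotv (V : normedModType R) (f g : V -> 'cV[R]_s) x v df dg :
  is_derive x v f df -> is_derive x v g dg ->
  is_derive x v (fun y => dotv (f y) (g y)) (dotv df (g x) + dotv (f x) dg).
Proof.
move=> [Df Ef] [Dg Eg].
have Dfi i : derivable (fun y => f y i 0) x v by have /derivable_mxP := Df.
have Dgi i : derivable (fun y => g y i 0) x v by have /derivable_mxP := Dg.
have -> : (fun y => dotv (f y) (g y)) =
   \sum_(i < s) ((fun y => f y i 0) * (fun y => g y i 0)).
  by apply/funext => y; rewrite dotvE fct_sumE; apply: eq_bigr.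
apply: is_derive_eq.
  apply: is_derive_sum => i.
  by apply: is_deriveM; exact: derivableP.
rewrite !dotvE -big_split /=; apply: eq_bigr => i _.
have -> : df i 0 = 'D_v (fun y => f y i 0) x by rewrite -Ef derive_coord.
have -> : dg i 0 = 'D_v (fun y => g y i 0) x by rewrite -Eg derive_coord.
by rewrite addrC; congr (_ + _); exact: mulrC.
Qed.

End Jacobian.

(** * Smooth curves in a regular level set *)

Lemma ball_fixed_point (R : realType) m n (f : 'M[R]_(m, n) -> 'M[R]_(m, n)) (e : R) :
  0 <= e -> (forall y, `|y| <= e -> `|f y| <= e) ->
  (forall y z, `|y| <= e -> `|z| <= e -> `|f y - f z| <= 2^-1 * `|y - z|) ->
  exists2 y, `|y| <= e & f y = y.
Proof.
move=> e0 fe fc; pose U := [set y : 'M[R]_(m, n) | `|y| <= e].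
have fU : {homo f : x / U x >-> U x} by move=> x; exact: fe.
have cU : closed U.
  apply: (@preimage_closed _ _ (fun y : 'M[R]_(m, n) => `|y|) [set r | r <= e]).
    by move=> y _; exact: norm_continuous.
  exact: closed_le.
pose X : completeNormedModType R := HB.pack 'M[R]_(m, n)
  (Uniform_isComplete.Build 'M[R]_(m, n) (@cauchy_cvg 'M[R]_(m, n))).
have [||| y Uy fy] := @banach_fixed_point R X U (mkfun fU).
- exists (2^-1)%:nng; split=> /=; first by rewrite invf_lt1 // ltr1n.
  by move=> [y z] [/= Uy Uz]; exact: fc.
- exact: cU.
- by exists 0; rewrite /U /= normr0.
by exists y.
Qed.

(** Substituting one bound into the other gives [Y <= W / 2 + Y / 2]. *)
Lemma ler_absorb_half (R : realType) (X Y W K e : R) :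
  0 <= e -> e <= 2^-1 -> 0 <= W -> e * (K * Y) <= 2^-1 * Y ->
  X <= W + K * Y -> Y <= e * X -> Y <= W.
Proof.
move=> e0 e2 W0 eK XW YX.
have : e * X <= e * (W + K * Y) by rewrite ler_wpM2l.
have : e * W <= 2^-1 * W by rewrite ler_wpM2r.
rewrite mulrDr; lra.
Qed.

Lemma ler_cancel_factors (R : realType) (A e K L H : R) :
  K = A + 1 -> 0 <= A -> 0 < L -> 0 <= e -> 0 <= H ->
  A * (e / (K * L) * (L * H)) <= e * H.
Proof.
move=> KA A0 L0 e0 H0; have K0 : 0 < K by rewrite KA ltr_wpDl.
have -> : A * (e / (K * L) * (L * H)) = A / K * (e * H).
  by field; rewrite !lt0r_neq0.
rewrite ler_piMl ?mulr_ge0 // ler_pdivrMr // mul1r KA lerDl //.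
Qed.

Section ImplicitCurve.
Context {R : realType} {s k : nat}.
Variables (F : 'cV[R]_s -> 'cV[R]_k) (p v : 'cV[R]_s) (B : 'M[R]_(s, k)).
Hypothesis cF : C1 F.
Hypothesis JB : Jac F p *m B = 1%:M.

(** The fixed [B] stays an approximate right inverse at nearby points; for [e < 1] this already
    makes [Jac F x *m B] injective. *)
Lemma near_right_inverse e : 0 < e -> exists2 d : R, 0 < d &
  forall x, `|x - p| <= d ->
  forall z : 'cV[R]_k, `|z - Jac F x *m B *m z| <= e * `|z|.
Proof.
move=> e0.
have c0 : 0 < s%:R * (k%:R * `|B|) + 1 by rewrite ltr_wpDl // !mulr_ge0.
have [d d0 H] := Jac_continuous cF p (divr_gt0 e0 c0).
exists d => // x /H xd z.
have -> : z - Jac F x *m B *m z = - ((Jac F x - Jac F p) *m (B *m z)).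
  by rewrite mulmxBl !mulmxA JB mul1mx opprB.
rewrite normrN; apply: le_trans (mulmx_norm _ _) _.
apply: (@le_trans _ _ (s%:R * (e / (s%:R * (k%:R * `|B|) + 1)) * (k%:R * `|B| * `|z|))).
  by apply: ler_pM; rewrite ?mulr_ge0 ?ler_wpM2l // mulmx_norm.
set c := _ + 1 in c0 *.
have -> : s%:R * (e / c) * (k%:R * `|B| * `|z|) =
          e * (s%:R * (k%:R * `|B|) / c) * `|z| by ring.
by rewrite ler_wpM2r // ler_piMr ?(ltW e0) // ler_pdivrMr // mul1r lerDl.
Qed.

Lemma near_unitmx : exists2 d : R, 0 < d &
  forall x, `|x - p| <= d -> Jac F x *m B \in unitmx.
Proof.
have [|d d0 H] := @near_right_inverse 2^-1; first by rewrite invr_gt0.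
exists d => // x /H {}H; apply: inj_unitmx => z Nz.
have := H z; rewrite Nz subr0 => h; apply/eqP; rewrite -normr_eq0.
by have := normr_ge0 z; move: h; rewrite eq_le => h0 h1; apply/andP; split; lra.
Qed.

Hypothesis Fp : F p = 0.
Hypothesis Jv : Jac F p *m v = 0.

(** Implicit differentiation of [F (p + r v + B y(r)) = 0] gives [(J B) y' = - J v], and the speed
    is [v + B y']. It depends on the point alone, so the curve solves an autonomous equation. *)
Definition curve_speed (x : 'cV[R]_s) : 'cV[R]_s :=
  v - B *m (invmx (Jac F x *m B) *m (Jac F x *m v)).

(** Newton's iteration with the derivative frozen at [p]: since [J B = 1] and [J v = 0], the linear
    part of [F (x r y)] in [y] is exactly [y], so [y - F (x r y)] is a contraction. The radius [d0]
    lets the curve stay where [F] describes [M]. *)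
Lemma implicit_curve (d0 : R) : 0 < d0 ->
  exists (r0 : R) (c : R -> 'cV[R]_s),
  [/\ 0 < r0, c 0 = p & forall r, `|r| < r0 ->
     [/\ F (c r) = 0, `|c r - p| <= d0, Jac F (c r) *m B \in unitmx &
         is_derive r 1 c (curve_speed (c r))]].
Proof.
move=> d00.
have b0 : 0 < k%:R * `|B| + 1 by rewrite ltr_wpDl // mulr_ge0.
have v0 : 0 < `|v| + 1 by rewrite ltr_wpDl.
pose e := 2^-1 / (k%:R * `|B| + 1).
have e0 : 0 < e by rewrite divr_gt0 // invr_gt0.
have [d1 d10 H1] := strict_derive cF p e0.
have [d2 d20 H2] := near_unitmx.
pose d := Num.min d0 (Num.min d1 d2).
have dp : 0 < d by rewrite !lt_min d00 d10.
have [dd0 dd1 dd2] : [/\ d <= d0, d <= d1 & d <= d2].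
  by rewrite /d !ge_min !lexx !orbT.
(* For [|y| <= eta] and [|r| <= r0] the displacements [B y] and [r v] are each at most [d / 2]. *)
pose eta := d / 2 / (k%:R * `|B| + 1).
have eta0 : 0 < eta by rewrite !divr_gt0.
pose r0 := eta / (`|v| + 1).
have r00 : 0 < r0 by rewrite divr_gt0.
pose x r (y : 'cV[R]_k) := p + r *: v + B *m y.
have etaB : k%:R * `|B| * eta <= d / 2.
  by rewrite /eta mulrC mulrAC ler_pdivrMr // ler_wpM2l ?lerDl // divr_ge0 // ltW.
have eta2 : eta <= d / 2.
  by rewrite /eta ler_pdivrMr // ler_peMr ?lerDr ?mulr_ge0 // ltW.
have xsub (r r' : R) (y y' : 'cV[R]_k) :
    x r y - x r' y' = (r - r') *: v + B *m (y - y').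
  rewrite /x scalerBl mulmxBr opprD addrACA opprD [X in X + _]addrACA.
  by rewrite subrr add0r.
have rv (r : R) : `|r| <= r0 -> `|r| * `|v| <= eta.
  by move=> h; rewrite -(divfK (lt0r_neq0 v0) eta) ler_pM // lerDl.
have Bn (y : 'cV[R]_k) : `|B *m y| <= k%:R * `|B| * `|y| by exact: mulmx_norm.
have xd (r : R) (y : 'cV[R]_k) : `|r| <= r0 -> `|y| <= eta -> `|x r y - p| <= d.
  move=> hr hy; rewrite /x -[p + _ + _]addrA [X in `|X|]addrC addKr.
  apply: le_trans (ler_normD _ _) _; rewrite normrZ [d]splitr lerD //.
    by apply: le_trans (rv _ hr) eta2.
  by apply: le_trans (Bn y) (le_trans _ etaB); rewrite ler_wpM2l ?mulr_ge0.
have eB (y : 'cV[R]_k) : e * (k%:R * `|B| * `|y|) <= 2^-1 * `|y|.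
  by rewrite mulrA ler_wpM2r // /e mulrAC ler_pdivrMr // ler_wpM2l ?lerDl.
have Jx (r r' : R) (y y' : 'cV[R]_k) : Jac F p *m (x r y - x r' y') = y - y'.
  rewrite xsub mulmxDr.
  by rewrite -scalemxAr Jv scaler0 add0r mulmxA JB mul1mx.
have xB (r r' : R) (y y' : 'cV[R]_k) : `|x r y - x r' y'| <= `|r - r'| * `|v| + k%:R * `|B| * `|y - y'|.
  rewrite xsub.
  by apply: le_trans (ler_normD _ _) _; rewrite normrZ lerD.
have strict (r r' : R) (y y' : 'cV[R]_k) : `|r| <= r0 -> `|r'| <= r0 -> `|y| <= eta -> `|y'| <= eta ->
   `|F (x r y) - F (x r' y') - (y - y')| <= e * `|x r y - x r' y'|.
  move=> hr hr' hy hy'; rewrite -(Jx r r' y y').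
  by apply: H1; apply: le_trans dd1; exact: xd.
have e2 : e <= 2^-1.
  by rewrite /e ler_pdivrMr // ler_peMr ?invr_ge0 // lerDr mulr_ge0.
have x00 : x 0 0 = p by rewrite /x scale0r mulmx0 !addr0.
(* The implication stands inside the existential, with the dummy value [0] for large [r], so that
   [choice] gives a total function. *)
have ex (r : R) : exists y, `|r| <= r0 -> `|y| <= eta /\ F (x r y) = 0.
  have [hr|hr] := leP `|r| r0; last by exists 0.
  have contr (y z : 'cV[R]_k) : `|y| <= eta -> `|z| <= eta ->
      `|y - F (x r y) - (z - F (x r z))| <= 2^-1 * `|y - z|.
    move=> hy hz; have h := strict r r y z hr hr hy hz.
    have := xB r r y z; rewrite subrr normr0 mul0r add0r => h2.
    apply: le_trans (eB (y - z)); apply: le_trans (ler_wpM2l (ltW e0) h2).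
    have -> : y - F (x r y) - (z - F (x r z)) = - (F (x r y) - F (x r z) - (y - z)).
      by rewrite [RHS]opprB !opprD !opprK addrACA.
    by rewrite normrN.
  have [|y hy Ey] := @ball_fixed_point R k 1 (fun y => y - F (x r y)) eta (ltW eta0) _ contr.
    move=> y hy; have := contr y 0 hy; rewrite normr0 => /(_ (ltW eta0)).
    rewrite sub0r opprK subr0 => h.
    have F0 : `|F (x r 0)| <= 2^-1 * eta.
      have := strict r 0 0 0 hr; rewrite !normr0 => /(_ (ltW r00) (ltW eta0) (ltW eta0)).
      rewrite x00 Fp !subr0 => h0.
      apply: le_trans h0 (ler_pM _ _ e2 _) => //; first exact: ltW.
      apply: le_trans (rv _ hr).
      by rewrite /x mulmx0 addr0 [p + _]addrC addrK normrZ.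
    rewrite -(subrK (- F (x r 0)) (y - F (x r y))) opprK.
    apply: le_trans (ler_normD _ _) _; rewrite normrN.
    apply: le_trans (lerD h F0) _.
    by rewrite -mulrDr mulrC ler_pdivrMr // mulr_natr mulr2n lerD2r.
  exists y => _; split=> //.
  by move/(congr1 (fun z => y - z)): Ey; rewrite subKr subrr.
have [y Hy] := choice ex.
(* Contains uniqueness ([r = r']), which gives [y 0 = 0], as well as Lipschitz dependence on [r]. *)
have uniq (r r' : R) (z z' : 'cV[R]_k) : `|r| <= r0 -> `|r'| <= r0 ->
    `|z| <= eta -> `|z'| <= eta -> F (x r z) = 0 -> F (x r' z') = 0 ->
    `|z - z'| <= `|r - r'| * `|v|.
  move=> hr hr' zr zr' Fr Fr'.
  have := strict r r' _ _ hr hr' zr zr'; rewrite Fr Fr' subrr sub0r normrN.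
  by apply: (ler_absorb_half (ltW e0) e2 _ (eB _) (xB _ _ _ _)); rewrite mulr_ge0.
have lip (r r' : R) : `|r| <= r0 -> `|r'| <= r0 -> `|y r - y r'| <= `|r - r'| * `|v|.
  by move=> hr hr'; have [? ?] := Hy r hr; have [? ?] := Hy r' hr'; exact: uniq.
have y0 : y 0 = 0.
  have h0 : `|0 : R| <= r0 by rewrite normr0 ltW.
  have [yr Fr] := Hy 0 h0.
  have n0 : `|0 : 'cV[R]_k| <= eta by rewrite normr0 ltW.
  have := uniq 0 0 (y 0) 0 h0 h0 yr n0 Fr; rewrite x00 => /(_ Fp).
  by rewrite !subr0 normr0 mul0r normr_le0 => /eqP.
pose c r := x r (y r).
exists r0, c; split=> //; first by rewrite /c /x y0 scale0r mulmx0 !addr0.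
move=> r hr.
have hr' := ltW hr; have [yr Fr] := Hy r hr'.
have cd := xd _ _ hr' yr.
have U : Jac F (c r) *m B \in unitmx by apply: H2; exact: le_trans cd dd2.
split=> //; first exact: le_trans cd dd0.
set N := Jac F (c r) *m B in U *.
pose L := `|v| + k%:R * `|B| * `|v| + 1.
have L0 : 0 < L by rewrite ltr_wpDl // addr_ge0 // !mulr_ge0.
have clip (r' : R) : `|r'| <= r0 -> `|c r' - c r| <= L * `|r' - r|.
  move=> h; apply: le_trans (xB _ _ _ _) _.
  apply: (@le_trans _ _ (`|r' - r| * `|v| + k%:R * `|B| * (`|r' - r| * `|v|))).
    by rewrite lerD2l ler_wpM2l ?mulr_ge0 // lip.
  have -> : `|r' - r| * `|v| + k%:R * `|B| * (`|r' - r| * `|v|) =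
    (`|v| + k%:R * `|B| * `|v|) * `|r' - r| by ring.
  by rewrite ler_wpM2r // lerDl.
pose K := k%:R * `|B| * (k%:R * `|invmx N|) + 1.
have K0 : 0 < K by rewrite ltr_wpDl // !mulr_ge0.
apply: is_derive_eps => e1 e10.
have [d3 d30 H3] := strict_derive cF (c r) (divr_gt0 e10 (mulr_gt0 K0 L0)).
exists (Num.min (r0 - `|r|) (d3 / L)).
  by rewrite lt_min subr_gt0 hr divr_gt0.
move=> h; rewrite le_min => /andP[hh1 hh2].
rewrite scaler1.
have hrh : `|r + h| <= r0 by apply: le_trans (ler_normD _ _) _; rewrite addrC -lerBrDr.
have := clip _ hrh; rewrite [r + h - r]addrC addKr => cl.
have := H3 (c (r + h)) (c r); rewrite subrr normr0 => /(_ _ (ltW d30)).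
have cl3 : `|c (r + h) - c r| <= d3.
  by apply: le_trans cl _; rewrite mulrC -ler_pdivlMr.
move=> /(_ cl3); rewrite /c Fr (Hy _ hrh).2 subrr sub0r normrN -/(c _) -/(c _) => {}H3.
pose D := Jac F (c r) *m (c (r + h) - c r).
(* [F] vanishes at both points, so [D] is nothing but the strict differentiability error and is
   small compared with [h]. *)
have E : c (r + h) - c r - h *: curve_speed (c r) = B *m (invmx N *m D).
  have Dc : c (r + h) - c r = h *: v + B *m (y (r + h) - y r).
    by rewrite /c xsub [r + h - r]addrC addKr.
  rewrite /D Dc /curve_speed -/N; move: (y (r + h) - y r) => dy.
  have -> : Jac F (c r) *m (h *: v + B *m dy) = h *: (Jac F (c r) *m v) + N *m dy.
    by rewrite mulmxDr -scalemxAr mulmxA.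
  rewrite (mulmxDr (invmx N)) mulKmx // mulmxDr -!scalemxAr scalerBr opprB.
  by rewrite [LHS]addrC addrA subrK.
rewrite E; apply: le_trans (mulmx_norm _ _) _.
apply: (@le_trans _ _ (k%:R * `|B| * (k%:R * `|invmx N| * (e1 / (K * L) * (L * `|h|))))).
  rewrite ler_wpM2l ?mulr_ge0 //; apply: le_trans (mulmx_norm _ _) _.
  rewrite ler_wpM2l ?mulr_ge0 //; apply: le_trans H3 _.
  by rewrite ler_wpM2l // divr_ge0 ?mulr_ge0 // ltW.
rewrite (mulrA (k%:R * `|B|)).
by apply: ler_cancel_factors; rewrite ?mulr_ge0 // ltW.
Qed.

End ImplicitCurve.

Lemma is_derive_reparam (R : realType) (V : normedModType R) (c : R -> V) (tau : R -> R) (r b : R) (u : V) :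
  is_derive r 1 tau b -> is_derive (tau r) 1 c u ->
  is_derive r 1 (fun x => c (tau x)) (b *: u).
Proof.
move=> dt dc; apply: is_derive_eps => e e0.
have b0 : 0 < `|b| + 1 by rewrite ltr_wpDl.
have u0 : 0 < `|u| + 1 by rewrite ltr_wpDl.
pose e1 := Num.min 1 (e / 2 / (`|u| + 1)).
have e10 : 0 < e1 by rewrite lt_min ltr01 !divr_gt0.
have [d1 d10 H1] := is_derive_eps_delta dt e10.
have e20 : 0 < e / 2 / (`|b| + 1) by rewrite !divr_gt0.
have [d2 d20 H2] := is_derive_eps_delta dc e20.
exists (Num.min d1 (d2 / (`|b| + 1))); first by rewrite lt_min d10 divr_gt0.
move=> h; rewrite le_min => /andP[hd1 hd2].
pose D := tau (r + h *: 1) - tau r.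
have {}H1 : `|D - h *: b| <= e1 * `|h| := H1 h hd1.
have Dh : `|D| <= (`|b| + 1) * `|h|.
  rewrite -(subrK (h *: b) D); apply: le_trans (ler_normD _ _) _.
  rewrite normrZ mulrDl addrC [`|h| * _]mulrC lerD // (le_trans H1) // ler_wpM2r //.
  by rewrite /e1 ge_min lexx.
have Dd : `|D| <= d2 by apply: le_trans Dh _; rewrite mulrC -ler_pdivlMr.
have := H2 D Dd; have -> : tau r + D *: 1 = tau (r + h *: 1).
  by rewrite [D *: 1]mulr1 /D addrC subrK.
move=> {}H2.
have -> : c (tau (r + h *: 1)) - c (tau r) - h *: (b *: u) =
   (c (tau (r + h *: 1)) - c (tau r) - D *: u) + (D - h *: b) *: u.
  have -> : (D - h *: b) *: u = D *: u - h *: (b *: u) by rewrite scalerBl scalerA.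
  by rewrite addrA subrK.
apply: le_trans (ler_normD _ _) _; rewrite [e]splitr mulrDl lerD //.
  apply: le_trans H2 (le_trans (ler_wpM2l (ltW e20) Dh) _).
  by rewrite mulrA divfK ?lt0r_neq0.
rewrite normrZ; apply: (@le_trans _ _ (e1 * `|h| * (`|u| + 1))).
  by rewrite ler_pM // lerDl.
by rewrite mulrAC ler_wpM2r // -ler_pdivlMr // /e1 ge_min lexx orbT.
Qed.

Lemma is_derive_mulr (R : realType) (a r : R) : is_derive r 1 ( *%R a) a.
Proof.
apply: is_derive_eps => e e0; exists 1 => // h _.
have -> : a * (r + h *: 1) - a * r - h *: a = 0.
  by rewrite [h *: 1]mulr1 [h *: a]mulrC; ring.
by rewrite normr0 mulr_ge0 // ltW.
Qed.

Lemma is_derive_dir (R : realType) (W : normedModType R) (f : R -> W) (r v : R) (d : W) :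
  is_derive r 1 f d -> is_derive r v f (v *: d).
Proof.
move=> df; apply: is_derive_eps => e e0.
have v0 : 0 < `|v| + 1 by rewrite ltr_wpDl.
have [d0 d00 H] := is_derive_eps_delta df (divr_gt0 e0 v0).
exists (d0 / (`|v| + 1)); first exact: divr_gt0.
move=> h hd; have := H (h * v).
have hv : `|h * v| <= d0 by rewrite normrM -(divfK (lt0r_neq0 v0) d0) ler_pM // lerDl.
move=> /(_ hv).
have -> : (h * v) *: (1 : R) = h *: v by rewrite [LHS]mulr1.
rewrite -[(h * v) *: d]scalerA.
move=> h1; apply: le_trans h1 _.
rewrite normrM.
have -> : e / (`|v| + 1) * (`|h| * `|v|) = e * `|h| * (`|v| / (`|v| + 1)) by ring.
by rewrite ler_piMr ?mulr_ge0 ?(ltW e0) // ler_pdivrMr // mul1r lerDl.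
Qed.

(** * All derivatives of a solution curve *)

Section CurveClass.
Context {R : realType} {s : nat}.
Variables (g : R -> 'cV[R]_s) (a : R).

(* A class of functions that is closed under differentiation when [g] solves an autonomous equation with right-hand side in the class; this gives all derivatives of [g] at once. *)
Inductive curve_class : (R -> R) -> Prop :=
| Curve_smooth k (f : 'cV[R]_s -> 'cV[R]_k) i : smooth f ->
    curve_class (fun r => f (g r) i 0)
| Curve_coord i : curve_class (fun r => g r i 0)
| Curve_cst c : curve_class (fun=> c)
| Curve_sin : curve_class (fun r => sin (a * r))
| Curve_cos : curve_class (fun r => cos (a * r))
| Curve_add f h : curve_class f -> curve_class h -> curve_class (fun r => f r + h r)
| Curve_mul f h : curve_class f -> curve_class h -> curve_class (fun r => f r * h r)
| Curve_inv f : curve_class f -> (forall r, f r != 0) ->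
    curve_class (fun r => (f r)^-1).

Lemma Curve_sum (I : Type) (l : seq I) (Q : pred I) (f : I -> R -> R) :
  (forall i, curve_class (f i)) -> curve_class (fun r => \sum_(i <- l | Q i) f i r).
Proof.
move=> cf; elim: l => [|i l IH].
  by under eq_fun do rewrite big_nil; exact: Curve_cst.
under eq_fun do rewrite big_cons.
by case: (Q i) => //; apply: Curve_add.
Qed.

Lemma Curve_prod (I : Type) (l : seq I) (Q : pred I) (f : I -> R -> R) :
  (forall i, curve_class (f i)) -> curve_class (fun r => \prod_(i <- l | Q i) f i r).
Proof.
move=> cf; elim: l => [|i l IH].
  by under eq_fun do rewrite big_nil; exact: Curve_cst.
under eq_fun do rewrite big_cons.
by case: (Q i) => //; apply: Curve_mul.
Qed.

Definition curve_mx m n (A : R -> 'M[R]_(m, n)) :=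
  forall i j, curve_class (fun r => A r i j).

Lemma curve_mx_cst m n (A : 'M[R]_(m, n)) : curve_mx (fun=> A).
Proof. by move=> i j; exact: Curve_cst. Qed.

Lemma curve_mx_mul m n q (A : R -> 'M[R]_(m, n)) (B : R -> 'M[R]_(n, q)) :
  curve_mx A -> curve_mx B -> curve_mx (fun r => A r *m B r).
Proof.
move=> cA cB i j; under eq_fun do rewrite mxE.
by apply: Curve_sum => k; apply: Curve_mul.
Qed.

Lemma curve_mx_det n (A : R -> 'M[R]_n) : curve_mx A -> curve_class (fun r => \det (A r)).
Proof.
move=> cA; apply: Curve_sum => t; apply: Curve_mul; first exact: Curve_cst.
by apply: Curve_prod => i; exact: cA.
Qed.

(** Cramer's rule. The determinant must be nonzero for every real [r], which the bounded time
    guarantees in the application. *)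
Lemma curve_mx_inv n (A : R -> 'M[R]_n) : curve_mx A -> (forall r, A r \in unitmx) ->
  curve_mx (fun r => invmx (A r)).
Proof.
move=> cA uA i j.
have -> : (fun r => invmx (A r) i j) =
    (fun r => (\det (A r))^-1 * ((-1) ^+ (j + i) * \det (row' j (col' i (A r))))).
  by apply/funext => r; rewrite /invmx uA !mxE.
apply: Curve_mul; first apply: Curve_inv.
- exact: curve_mx_det.
- by move=> r; have := uA r; rewrite unitmxE unitfE.
apply: Curve_mul; first exact: Curve_cst.
apply: curve_mx_det => k l; under eq_fun do rewrite !mxE; exact: cA.
Qed.

Variable w : R -> 'cV[R]_s.
Hypothesis dg : forall r : R, is_derive r 1 g (w r).
Hypothesis cw : curve_mx w.

(** Induction on the class. The differential equation enters in the first two cases, where the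
    derivative of [g] is replaced by [w], again in the class. *)
Lemma curve_class_derive f : curve_class f ->
  exists2 f', curve_class f' & forall r : R, is_derive r 1 f (f' r).
Proof.
elim=> {f} [k f i sf|i|c|||f h _ [f' cf' df] _ [h' ch' dh]
           |f h cf [f' cf' df] ch [h' ch' dh]|f cf [f' cf' df] f0].
- exists (fun r => \sum_j 'D_(delta_mx j 0) f (g r) i 0 * w r j 0).
    apply: Curve_sum => j; apply: Curve_mul; last exact: cw.
    by apply: (@Curve_smooth _ ('D_(delta_mx j 0) f)); exact: smooth_derive.
  move=> r; have [D E] := is_derive_comp_curve (smooth_C1 sf) (dg r).
  apply: DeriveDef; first by have /derivable_mxP := D.
  by rewrite -derive_coord // E mxE; apply: eq_bigr => j _; rewrite mxE.
- exists (fun r => w r i 0) => // r; have [D E] := dg r.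
  apply: DeriveDef; first by have /derivable_mxP := D.
  by rewrite -derive_coord // E.
- by exists (fun=> 0); [exact: Curve_cst | move=> r; exact: is_derive_cst].
- exists (fun r => a * cos (a * r)).
    by apply: Curve_mul; [exact: Curve_cst | exact: Curve_cos].
  by move=> r; apply: is_derive_reparam; exact: is_derive_mulr.
- exists (fun r => - a * sin (a * r)).
    by apply: Curve_mul; [exact: Curve_cst | exact: Curve_sin].
  move=> r; rewrite mulNr -mulrN.
  by apply: is_derive_reparam; exact: is_derive_mulr.
- exists (fun r => f' r + h' r); first exact: Curve_add.
  by move=> r; exact: is_deriveD.
- exists (fun r => f r * h' r + h r * f' r).
    by apply: Curve_add; exact: Curve_mul.
  by move=> r; exact: is_deriveM.
- exists (fun r => - 1 * ((f r)^-1 * (f r)^-1 * f' r)).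
    apply: Curve_mul; first exact: Curve_cst.
    by apply: Curve_mul => //; apply: Curve_mul; exact: Curve_inv.
  move=> r; have [D E] := df r; apply: DeriveDef; first exact: derivableV.
  by rewrite deriveV // E mulN1r expr2 invfM scaleNr.
Qed.

Lemma curve_class_smooth f : curve_class f -> smooth f.
Proof.
move=> cf vs.
have [h ch ->] : exists2 h, curve_class h & iter_deriv f vs = h.
  elim: vs => [|v vs [h ch E]] /=; first by exists f.
  have [h' ch' dh] := curve_class_derive ch.
  exists (fun r => v * h' r); first by apply: Curve_mul => //; exact: Curve_cst.
  apply/funext => r; rewrite E.
  exact: (@derive_val _ _ _ _ _ _ _ (is_derive_dir v (dh r))).
have [h' _ dh] := curve_class_derive ch.
split=> [v x|x]; first by have [] := is_derive_dir v (dh x).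
by apply: differentiable_continuous; apply/derivable1_diffP; have [] := dh x.
Qed.

Lemma curve_smooth : smooth g.
Proof.
apply: smooth_coords => i j; rewrite ord1.
by apply: curve_class_smooth; exact: Curve_coord.
Qed.

End CurveClass.

Lemma Jac_surj_right_inverse (R : realType) s k (F : 'cV[R]_s -> 'cV[R]_k) x :
  C1 F -> (forall y, exists v, 'D_v F x = y) -> exists B, Jac F x *m B = 1%:M.
Proof.
move=> cF surj; have [b Hb] := choice (fun j : 'I_k => surj (delta_mx j 0)).
exists (\matrix_(i, j) b j i 0); apply/matrixP => i j.
have -> : 1%:M i j = (Jac F x *m b j) i 0.
  by rewrite -derive_Jac // Hb !mxE eqxx andbT.
by rewrite !mxE; apply: eq_bigr => l _; rewrite !mxE.
Qed.

Lemma ker_tangent (R : realType) s k (M U : set 'cV[R]_s)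
    (F : 'cV[R]_s -> 'cV[R]_k) (p v : 'cV[R]_s) (B : 'M[R]_(s, k)) :
  open U -> smooth F -> (forall x, U x -> (M x <-> F x = 0)) -> U p -> M p ->
  Jac F p *m B = 1%:M -> Jac F p *m v = 0 -> tangent_space M p v.
Proof.
move=> oU sF UM Up Mp JB Jv; have cF := smooth_C1 sF.
have Fp : F p = 0 by apply/(UM p Up).
have [d /= d0 Ud] : exists2 d : R, 0 < d & forall x, `|x - p| <= d -> U x.
  have /nbhs_ballP [d /= d0 H] : nbhs p U by apply: open_nbhs_nbhs.
  exists (d / 2); first by rewrite divr_gt0.
  move=> x xp; apply: H; rewrite -ball_normE /= distrC.
  by apply: le_lt_trans xp _; rewrite ltr_pdivrMr // ltr_pMr // ltr1n.
have [r0 [c [r00 c0 Hc]]] := implicit_curve cF JB Fp Jv d0.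
(* With this [q], [tau] stays in [[-q, q]], inside the open interval of existence, while [tau 0 = 0]
   and [tau' 0 = 1] preserve the base point and the velocity. *)
pose q := r0 / 2; have q0 : 0 < q by rewrite divr_gt0.
pose tau r := q * sin (q^-1 * r).
have tr r : `|tau r| < r0.
  rewrite /tau normrM gtr0_norm //; apply: (@le_lt_trans _ _ q).
    by rewrite ler_piMr ?sin_max // ltW.
  by rewrite /q ltr_pdivrMr // ltr_pMr // ltr1n.
pose g r := c (tau r).
pose w r := cos (q^-1 * r) *: curve_speed F v B (g r).
have dtau (r : R) : is_derive r 1 tau (cos (q^-1 * r)).
  have := is_derive_reparam (is_derive_reparam (is_derive_mulr q^-1 r) (is_derive_sin _))
    (is_derive_mulr q _).
  have -> // : (q^-1 *: cos (q^-1 * r)) *: q = cos (q^-1 * r).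
  by rewrite -[LHS]/(q^-1 * cos _ * q) mulrAC mulVf ?mul1r // lt0r_neq0.
have dg (r : R) : is_derive r 1 g (w r).
  have [_ _ _ dc] := Hc _ (tr r).
  exact: is_derive_reparam.
have cw : curve_mx g q^-1 w.
  move=> i j; rewrite ord1.
  have cJ : curve_mx g q^-1 (fun r => Jac F (g r)).
    move=> k' l; under eq_fun do rewrite mxE.
    by apply: (@Curve_smooth _ _ _ _ _ ('D_(delta_mx l 0) F)); exact: smooth_derive.
  have cst m n (A : 'M[R]_(m, n)) : curve_mx g q^-1 (fun=> A) by exact: curve_mx_cst.
  have cS : curve_mx g q^-1 (fun r => B *m (invmx (Jac F (g r) *m B) *m (Jac F (g r) *m v))).
    apply: curve_mx_mul => //; apply: curve_mx_mul.
      apply: curve_mx_inv; first exact: curve_mx_mul.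
      by move=> r; have [] := Hc _ (tr r).
    exact: curve_mx_mul.
  have -> : (fun r => w r i 0) = (fun r => cos (q^-1 * r) * (v i 0 + -1 *
      (B *m (invmx (Jac F (g r) *m B) *m (Jac F (g r) *m v))) i 0)).
    by apply/funext => r; rewrite /w /curve_speed !mxE mulN1r.
  apply: Curve_mul; first exact: Curve_cos.
  apply: Curve_add; first exact: Curve_cst.
  by apply: Curve_mul; [exact: Curve_cst | exact: cS].
exists g; split; first exact: curve_smooth dg cw.
- move=> r; have [F0 cd _ _] := Hc _ (tr r).
  by apply/(UM _ (Ud _ cd)).
- by rewrite /g /tau mulr0 sin0 mulr0.
rewrite (@derive_val _ _ _ _ _ _ _ (dg 0)) /w mulr0 cos0 scale1r.
by rewrite /g /tau mulr0 sin0 mulr0 c0 /curve_speed Jv !mulmx0 subr0.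
Qed.

(** * First-order behaviour of the nearest point *)

Lemma dotv_delta (R : realType) s (y : 'cV[R]_s) i : dotv (delta_mx i 0) y = y i 0.
Proof.
rewrite dotvE (bigD1 i) //= big1 ?addr0; first by rewrite mxE !eqxx mul1r.
by move=> l li; rewrite mxE (negbTE li) mul0r.
Qed.

Lemma is_derive_mulmx (R : realType) (V : normedModType R) s k (B : 'M[R]_(s, k))
    (f : V -> 'cV[R]_k) x v w :
  is_derive x v f w -> is_derive x v (fun y => B *m f y) (B *m w).
Proof.
move=> df; apply: is_derive_eps => e e0.
have b0 : 0 < k%:R * `|B| + 1 by rewrite ltr_wpDl // mulr_ge0.
have [d d0 H] := is_derive_eps_delta df (divr_gt0 e0 b0).
exists d => // h /H {}H.
have -> : B *m f (x + h *: v) - B *m f x - h *: (B *m w) =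
          B *m (f (x + h *: v) - f x - h *: w) by rewrite !mulmxBr -scalemxAr.
apply: le_trans (mulmx_norm _ _) _.
apply: le_trans (ler_wpM2l _ H) _; first by rewrite mulr_ge0.
have -> : k%:R * `|B| * (e / (k%:R * `|B| + 1) * `|h|) =
   e * `|h| * (k%:R * `|B| / (k%:R * `|B| + 1)) by ring.
by rewrite ler_piMr ?mulr_ge0 ?(ltW e0) // ler_pdivrMr // mul1r lerDl.
Qed.

(** With [u = mu' - mu], [h = x - t] and [D] the increment of [nu], each term on the right is a
    separate error: the normal part of [u] (twice), the linearization of [nu], and the projected
    normal vector [h - u - D]. *)
Lemma expansion_identity (R : realType) s (P A : 'M[R]_s) (u h D : 'cV[R]_s) :
  (1%:M + P *m A *m P) *m u - P *m h =
  (u - P *m u) - P *m A *m (u - P *m u) + P *m (A *m u - D) - P *m (h - u - D).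
Proof.
rewrite !mulmxBr mulmxDl mul1mx -!mulmxA.
move: (P *m (A *m (P *m u))) (P *m (A *m u)) (P *m u) (P *m h) (P *m D) => a b c e f.
by apply/colP => i; rewrite !mxE; ring.
Qed.

Section NearestPoint.
Context {R : realType} {s : nat}.
Implicit Types (M : set 'cV[R]_s) (x y t mu v : 'cV[R]_s).

(** On the compact part of [M] outside the [e]-ball about [mu], the distance to [t] exceeds its
    minimum over [M] by some [g > 0]. Moving [t] by at most [g / 3] changes the comparison by at
    most [2 g / 3]. *)
Lemma nearest_continuous M t mu : compact M ->
  (forall mu', nearest M t mu' -> mu' = mu) -> nearest M t mu ->
  forall e : R, 0 < e -> exists2 d : R, 0 < d &
    forall x mu', `|x - t| <= d -> nearest M x mu' -> `|mu' - mu| <= e.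
Proof.
move=> cM uniq [Mmu nmu] e e0.
pose K := M `&` [set y | e <= `|y - mu|].
have cK : compact K.
  apply: compact_closedI cM _.
  apply: (@preimage_closed _ _ (fun y : 'cV[R]_s => `|y - mu|) [set r | e <= r]).
    by move=> y _; exact: cvg_norm (cvgB cvg_id (cvg_cst _)).
  exact: closed_ge.
have [K0|K0] := pselect (K !=set0); last first.
  exists 1 => // x mu' _ [Mmu' _]; rewrite leNgt; apply/negP => lt_e.
  by apply: K0; exists mu'; split=> //=; exact: ltW.
have dc : {within K, continuous (fun y => dotv (y - t) (y - t))}.
  apply: continuous_subspaceT => y.
  have -> : (fun y => dotv (y - t) (y - t)) =
     \sum_(i < s) (fun y : 'cV[R]_s => (y i 0 - t i 0) * (y i 0 - t i 0)).
    apply/funext => z; rewrite dotvE fct_sumE; apply: eq_bigr => i _.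
    by rewrite !mxE.
  apply: differentiable_continuous; apply: differentiable_sum => i.
  by apply: differentiableM; apply: differentiableB => //; exact: differentiable_coord.
have [y0 /set_mem [My0 /= ey0] miny0] := compact_EVT_min K0 cK dc.
have gap : enorm (mu - t) < enorm (y0 - t).
  rewrite lt_neqAle nmu // andbT; apply/eqP => E.
  have : y0 = mu by apply: uniq; split=> // y /nmu; rewrite E.
  by move=> Ey; move: ey0; rewrite Ey subrr normr0 leNgt e0.
pose g := enorm (y0 - t) - enorm (mu - t).
have g0 : 0 < g by rewrite subr_gt0.
have s0 : 0 < s%:R + 1 :> R by rewrite ltr_wpDl.
exists (g / 3 / (s%:R + 1)); first by rewrite !divr_gt0.
move=> x mu' xt [Mmu' nmu']; rewrite leNgt; apply/negP => lt_e.
have : K mu' by split=> //=; exact: ltW.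
move/mem_set/miny0; rewrite -enorm_le leNgt => /negP; apply.
have xt' : enorm (x - t) <= g / 3.
  apply: le_trans (enorm_le_norm _) _.
  apply: (@le_trans _ _ ((s%:R + 1) * (g / 3 / (s%:R + 1)))).
    by apply: ler_pM => //; rewrite lerDl.
  by rewrite mulrC divfK // lt0r_neq0.
have h1 : enorm (mu' - t) <= enorm (mu' - x) + enorm (x - t).
  by rewrite -[X in enorm X <= _](subrKA x) enormD.
have h2 : enorm (mu - x) <= enorm (mu - t) + enorm (x - t).
  by rewrite -(enormN (x - t)) opprB -[X in enorm X <= _](subrKA t) enormD.
have h3 := nmu' _ Mmu.
by move: h1 h2 h3 xt' g0; rewrite /g; lra.
Qed.

(** The squared distance to [x] along a curve in [M] through [mu] has a minimum at time [0]. *)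
Lemma nearest_normal M x mu v : nearest M x mu -> tangent_space M mu v ->
  dotv (x - mu) v = 0.
Proof.
move=> [Mmu nmu] [g [sg gM g0 g'0]].
have dg (r : R) : is_derive r 1 (fun r => g r - x) ('D_1 g r).
  rewrite -[X in is_derive _ _ _ X]subr0; apply: is_deriveB.
  by apply: derivableP; have [] := sg [::].
have df (r : R) := is_derive_dotv (dg r) (dg r).
have m0 : (0 : R) \in `](-1), 1[ by rewrite in_itv /= ltrN10 ltr01.
have [|r _|r _|] := @derive1_at_min _ (fun r => dotv (g r - x) (g r - x)) (-1) 1 0 _ _ m0.
- by lra.
- by have [] := df r.
- by rewrite -enorm_le g0; apply: nmu.
move=> _; rewrite (@derive_val _ _ _ _ _ _ _ (df 0)) g0 g'0 dotvC -mulr2n.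
move/eqP; rewrite mulrn_eq0 /= => /eqP E.
by rewrite -[x - mu]opprB dotvNl E oppr0.
Qed.

End NearestPoint.

(** * Tangent and normal vectors at points of [M] near [mu] *)

Section Chart.
Context {R : realType} {s k : nat}.
Variables (M U : set 'cV[R]_s) (F : 'cV[R]_s -> 'cV[R]_k) (mu : 'cV[R]_s).
Variable B : 'M[R]_(s, k).
Hypothesis oU : open U.
Hypothesis sF : smooth F.
Hypothesis UM : forall x, U x -> (M x <-> F x = 0).
Hypothesis Umu : U mu.
Hypothesis Mmu : M mu.
Hypothesis JB : Jac F mu *m B = 1%:M.

Let cF : C1 F := smooth_C1 sF.

Lemma open_delta : exists2 d : R, 0 < d & forall x, `|x - mu| <= d -> U x.
Proof.
have /nbhs_ballP [d /= d0 H] : nbhs mu U by apply: open_nbhs_nbhs.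
exists (d / 2); first by rewrite divr_gt0.
move=> x xp; apply: H; rewrite -ball_normE /= distrC.
by apply: le_lt_trans xp _; rewrite ltr_pdivrMr // ltr_pMr // ltr1n.
Qed.

Lemma tangent_ker w : tangent_space M mu w <-> Jac F mu *m w = 0.
Proof.
split; last by move=> Jw; exact: (ker_tangent oU sF UM Umu Mmu JB Jw).
move=> [g [sg gM g0 g'0]].
have dg : is_derive (0 : R) 1 g w.
  by rewrite -g'0; apply: derivableP; have [] := sg [::].
have := is_derive_comp_curve cF dg; rewrite g0 => dFg.
have d0 : is_derive (0 : R) 1 (fun r => F (g r)) 0.
  apply: (near_eq_is_derive _ (is_derive_cst (0 : 'cV[R]_k) (0 : R) 1)).
  have [d dp Ud] := open_delta.
  have gc : {for 0, continuous g} by have [_] := sg [::]; exact.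
  have [d1 d10 H] := cvg_eps_delta gc dp.
  apply/nbhs_ballP; exists d1 => //= r; rewrite -ball_normE /= distrC => rd.
  by apply/esym/(UM _).1 => //; apply: Ud; rewrite -g0; apply: H; exact: ltW.
by rewrite -(@derive_val _ _ _ _ _ _ _ dFg) (@derive_val _ _ _ _ _ _ _ d0).
Qed.

(** Subtracting [B z] moves [w] into the kernel of [Jac F y]. Since [Jac F y *m B] is close to [1],
    the correction [z] agrees with [Jac F y *m w] up to a small relative error. *)
Lemma tangent_lift e : 0 < e -> e <= 2^-1 -> exists2 d : R, 0 < d &
  forall y, M y -> `|y - mu| <= d -> forall w,
    let z := invmx (Jac F y *m B) *m (Jac F y *m w) in
    [/\ tangent_space M y (w - B *m z), `|z - Jac F y *m w| <= e * `|z| &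
        `|z| <= 2 * `|Jac F y *m w|].
Proof.
move=> e0 e2.
have [d1 d10 Ud] := open_delta.
have [d2 d20 H2] := near_unitmx cF JB.
have [d3 d30 H3] := near_right_inverse cF JB e0.
exists (Num.min d1 (Num.min d2 d3)); first by rewrite !lt_min d10 d20.
move=> y My; rewrite !le_min => /and3P[yd1 yd2 yd3] w z.
have uN := H2 _ yd2; have Uy := Ud _ yd1.
have Nz : Jac F y *m B *m z = Jac F y *m w by rewrite /z mulKVmx.
have zb : `|z - Jac F y *m w| <= e * `|z| by rewrite -Nz; exact: H3.
split=> //.
  apply: (@ker_tangent _ _ _ M U F y _ (B *m invmx (Jac F y *m B))) => //.
    by rewrite mulmxA mulmxV.
  by rewrite mulmxBr mulmxA Nz subrr.
have : `|z| <= `|z - Jac F y *m w| + `|Jac F y *m w|.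
  by rewrite -{1}(subrK (Jac F y *m w) z) ler_normD.
have : e * `|z| <= 2^-1 * `|z| by rewrite ler_wpM2r.
move: zb; move: (`|z - _|) (`|z|) (`|Jac F y *m w|) (e * _) => a b c f; lra.
Qed.

Lemma tangent_near (w : 'cV[R]_s) : Jac F mu *m w = 0 -> forall e : R, 0 < e ->
  exists2 d : R, 0 < d & forall y, M y -> `|y - mu| <= d ->
    exists2 w', tangent_space M y w' & `|w' - w| <= e.
Proof.
move=> Jw e e0.
have [d1 d10 H1] := @tangent_lift 2^-1 (ltac:(by rewrite invr_gt0)) (lexx _).
have c0 : 0 < k%:R * `|B| * (2 * (s%:R * `|w|)) + 1 by rewrite ltr_wpDl // !mulr_ge0.
have [d2 d20 H2] := Jac_continuous cF mu (divr_gt0 e0 c0).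
exists (Num.min d1 d2); first by rewrite lt_min d10.
move=> y My; rewrite le_min => /andP[yd1 yd2].
have [Tw _ zb] := H1 y My yd1 w.
eexists; first exact: Tw.
rewrite addrAC subrr add0r normrN; apply: le_trans (mulmx_norm _ _) _.
have Jyw : `|Jac F y *m w| <= s%:R * (e / (k%:R * `|B| * (2 * (s%:R * `|w|)) + 1)) * `|w|.
  have -> : Jac F y *m w = (Jac F y - Jac F mu) *m w by rewrite mulmxBl Jw subr0.
  by apply: le_trans (mulmx_norm _ _) _; rewrite ler_wpM2r // ler_wpM2l // H2.
apply: le_trans (ler_wpM2l _ (le_trans zb (ler_wpM2l _ Jyw))) _; rewrite ?mulr_ge0 //.
set c := _ + 1 in c0 *.
have -> : k%:R * `|B| * (2 * (s%:R * (e / c) * `|w|)) =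
   e * ((k%:R * `|B| * (2 * (s%:R * `|w|))) / c) by ring.
by rewrite ler_piMr ?(ltW e0) // ler_pdivrMr // mul1r lerDl.
Qed.

Variable P : 'M[R]_s.
Hypothesis HP : is_tan_proj M mu P.

Let Pt : P^T = P. Proof. by case: HP. Qed.
Let PP : P *m P = P. Proof. by case: HP. Qed.

Lemma proj_kerE (w : 'cV[R]_s) : Jac F mu *m w = 0 <-> P *m w = w.
Proof. by case: HP => _ _ E; rewrite -tangent_ker. Qed.

Lemma tan_proj_rank : \rank P = (s - k)%N.
Proof.
have -> : \rank P = \rank (kermx (Jac F mu)^T).
  apply: eqmx_rank; apply/andP; split.
    apply/sub_kermxP; rewrite -{1}Pt -trmx_mul.
    suff -> : Jac F mu *m P = 0 by rewrite trmx0.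
    apply/matrixP => i j; rewrite [RHS]mxE.
    have /proj_kerE/colP/(_ i) : P *m col j P = col j P by rewrite !colE mulmxA PP.
    rewrite !mxE => E; rewrite -[RHS]E; apply: eq_bigr => l _.
    by rewrite !mxE.
  apply/row_subP => i; set u := row i _.
  have : u *m (Jac F mu)^T = 0 by apply/sub_kermxP; exact: row_sub.
  move/(congr1 trmx); rewrite trmx_mul trmxK trmx0 => /proj_kerE.
  move/(congr1 trmx); rewrite trmx_mul trmxK Pt => <-; exact: submxMl.
rewrite mxrank_ker mxrank_tr.
have /eqP -> // : row_free (Jac F mu) by apply/row_freeP; exists B.
Qed.

(** The coordinates of [P q] are the products of [q] with the vectors [P e_i], which are tangent at
    [mu] and hence close to tangent vectors at [y], to which [q] is orthogonal. *)
Lemma normal_small e : 0 < e -> exists2 d : R, 0 < d &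
  forall y, M y -> `|y - mu| <= d -> forall q,
    (forall v, tangent_space M y v -> dotv q v = 0) -> `|P *m q| <= e * `|q|.
Proof.
move=> e0; have s0 : 0 < s%:R + 1 :> R by rewrite ltr_wpDl.
have [i d d' _ dd' H y My yd|i|d d0 Hd] := @exists_delta_forall R 'I_s (fun i d =>
  forall y, M y -> `|y - mu| <= d -> exists2 w', tangent_space M y w' &
    `|w' - P *m delta_mx i 0| <= e / (s%:R + 1)).
- by apply: H => //; exact: le_trans yd dd'.
- apply: tangent_near; last exact: divr_gt0.
  by apply/proj_kerE; rewrite mulmxA PP.
exists d => // y My yd q Nq; apply: norm_le_coord => [|i j].
  by rewrite mulr_ge0 // ltW.
rewrite ord1.
have -> : (P *m q) i 0 = dotv q (P *m delta_mx i 0).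
  by rewrite dotvC dotv_mulmxl Pt dotv_delta.
have [w' Tw' ww'] := Hd i y My yd.
have -> : dotv q (P *m delta_mx i 0) = - dotv q (w' - P *m delta_mx i 0).
  by rewrite dotvBr opprB (Nq _ Tw') subr0.
rewrite normrN.
apply: le_trans (dotv_le_norm _ _) _.
apply: le_trans (ler_wpM2l _ ww') _; first by rewrite mulr_ge0.
have -> : s%:R * `|q| * (e / (s%:R + 1)) = e * `|q| * (s%:R / (s%:R + 1)) by ring.
by rewrite ler_piMr ?mulr_ge0 ?(ltW e0) // ler_pdivrMr // mul1r lerDl.
Qed.

(** [u - B J u] lies in the kernel of [J], so [P] fixes it and [u - P u = (B - P B) J u]; as [F]
    vanishes at [y] and [mu], [J u] is of higher order in [u]. *)
Lemma proj_near e : 0 < e -> exists2 d : R, 0 < d &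
  forall y, M y -> `|y - mu| <= d -> `|y - mu - P *m (y - mu)| <= e * `|y - mu|.
Proof.
move=> e0.
pose C := B - P *m B.
have c0 : 0 < k%:R * `|C| + 1 by rewrite ltr_wpDl // mulr_ge0.
have [d1 d10 Ud] := open_delta.
have [d2 d20 H2] := strict_derive cF mu (divr_gt0 e0 c0).
exists (Num.min d1 d2); first by rewrite lt_min d10.
move=> y My; rewrite le_min => /andP[yd1 yd2]; set u := y - mu.
have E : u - P *m u = C *m (Jac F mu *m u).
  have /proj_kerE : Jac F mu *m (u - B *m (Jac F mu *m u)) = 0.
    by rewrite mulmxBr (mulmxA (Jac F mu)) JB mul1mx subrr.
  rewrite mulmxBr => /eqP; rewrite subr_eq => /eqP ->.
  by rewrite /C mulmxBl -mulmxA opprD addrA opprB addrCA subrr addr0.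
rewrite E; apply: le_trans (mulmx_norm _ _) _.
have := H2 y mu yd2; rewrite subrr normr0 => /(_ (ltW d20)).
rewrite ((UM (Ud _ yd1)).1 My) ((UM Umu).1 Mmu) subrr sub0r normrN -/u => h.
apply: le_trans (ler_wpM2l _ h) _; first by rewrite mulr_ge0.
have -> : k%:R * `|C| * (e / (k%:R * `|C| + 1) * `|u|) =
   e * `|u| * (k%:R * `|C| / (k%:R * `|C| + 1)) by ring.
by rewrite ler_piMr ?mulr_ge0 ?(ltW e0) // ler_pdivrMr // mul1r lerDl.
Qed.

Variables (nu : 'cV[R]_s -> 'cV[R]_s) (t : 'cV[R]_s).
Hypothesis Nnu : normal_field M nu.
Hypothesis nut : nu mu = t - mu.

Let cnu : C1 nu := smooth_C1 Nnu.1.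
Let A := Jac nu mu.

(* [q = x - mu' - nu mu'] is normal at [mu'], hence [P q] is small. *)
Lemma nearest_expansion e : 0 < e -> exists2 d : R, 0 < d &
  forall x mu', `|mu' - mu| <= d -> nearest M x mu' ->
    `|(1%:M + P *m A *m P) *m (mu' - mu) - P *m (x - t)|
      <= e * (`|x - t| + `|mu' - mu|).
Proof.
move=> e0.
(* The sum of the coefficients of [|u|] in the four error terms; each error carries the common
   factor [e1]. *)
pose K := 1 + s%:R * `|P *m A| + s%:R * `|P| + (2 + s%:R * `|A|).
have sA0 : 0 <= s%:R * `|A| by rewrite mulr_ge0.
have sPA0 : 0 <= s%:R * `|P *m A| by rewrite mulr_ge0.
have sP0 : 0 <= s%:R * `|P| by rewrite mulr_ge0.
have K0 : 0 < K by rewrite /K; lra.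
pose e1 := Num.min 1 (e / K).
have e10 : 0 < e1 by rewrite lt_min ltr01 divr_gt0.
have e11 : e1 <= 1 by rewrite ge_min lexx.
have e1K : e1 * K <= e by rewrite -ler_pdivlMr // ge_min lexx orbT.
have [d1 d10 H1] := normal_small e10.
have [d2 d20 H2] := proj_near e10.
have [d3 d30 H3] := strict_derive cnu mu e10.
exists (Num.min d1 (Num.min d2 d3)); first by rewrite !lt_min d10 d20.
move=> x mu'; rewrite !le_min => /and3P[y1 y2 y3] nx.
have [My _] := nx.
set u := mu' - mu; set h := x - t.
pose D := nu mu' - nu mu.
pose q := x - mu' - nu mu'.
have qE : q = h - u - D.
  by rewrite /q /h /u /D nut; apply/colP => i; rewrite !mxE; ring.
have Pq : `|P *m q| <= e1 * `|q|.
  apply: (H1 mu') => // v Tv.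
  by rewrite dotvBl (nearest_normal nx Tv) (Nnu.2 _ My _ Tv) subrr.
have uPu : `|u - P *m u| <= e1 * `|u| by exact: H2.
have := H3 mu' mu y3; rewrite subrr normr0 => /(_ (ltW d30)).
rewrite -/u -/D -/A => Du.
have qn : `|q| <= `|h| + (2 + s%:R * `|A|) * `|u|.
  have Dn : `|D| <= (1 + s%:R * `|A|) * `|u|.
    rewrite -(subrK (A *m u) D); apply: le_trans (ler_normD _ _) _.
    rewrite mulrDl mul1r lerD ?mulmx_norm //; apply: le_trans Du _.
    by rewrite ler_piMl.
  rewrite qE; apply: le_trans (ler_normB _ _) _.
  apply: le_trans (lerD (ler_normB _ _) Dn) _.
  by rewrite -addrA lerD2l -{1}[`|u|]mul1r -mulrDl addrA.
have -> : (1%:M + P *m A *m P) *m u - P *m h =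
   (u - P *m u) - P *m A *m (u - P *m u) + P *m (A *m u - D) - P *m q.
  by rewrite qE; exact: expansion_identity.
have n1 : `|P *m A *m (u - P *m u)| <= s%:R * `|P *m A| * (e1 * `|u|).
  by apply: le_trans (mulmx_norm _ _) _; rewrite ler_wpM2l.
have n2 : `|P *m (A *m u - D)| <= s%:R * `|P| * (e1 * `|u|).
  by apply: le_trans (mulmx_norm _ _) _; rewrite ler_wpM2l // distrC.
have n3 : `|P *m q| <= e1 * (`|h| + (2 + s%:R * `|A|) * `|u|).
  by apply: le_trans Pq _; rewrite ler_wpM2l // ltW.
apply: le_trans (ler_normB _ _) _.
apply: le_trans (lerD (le_trans (ler_normD _ _) (lerD (le_trans (ler_normB _ _)
  (lerD uPu n1)) n2)) n3) _.
apply: (@le_trans _ _ (e1 * K * (`|h| + `|u|))); last by rewrite ler_wpM2r // addr_ge0.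
have -> : e1 * `|u| + s%:R * `|P *m A| * (e1 * `|u|) + s%:R * `|P| * (e1 * `|u|)
   + e1 * (`|h| + (2 + s%:R * `|A|) * `|u|) = e1 * (K * `|u| + `|h|).
  by rewrite /K; ring.
rewrite -mulrA ler_wpM2l ?(ltW e10) // mulrDr addrC lerD2r ler_peMl //.
by rewrite /K; lra.
Qed.

(** Along a curve in [M] with velocity [v], the corrected vector [w - B z(r)] is tangent, hence
    orthogonal to [nu]. Differentiating at [0], where [z = 0] and [z' = D_v D_w F], expresses the
    shape form by second derivatives of [F]. *)
Lemma normal_derive_tangent (v w : 'cV[R]_s) : P *m v = v -> P *m w = w ->
  dotv (A *m v) w = dotv (nu mu) (B *m 'D_v ('D_w F) mu).
Proof.
move=> Pv Pw; have /proj_kerE Jv := Pv; have /proj_kerE Jw := Pw.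
have [g [sg gM g0 g'0]] := (tangent_ker v).2 Jv.
have dg : is_derive (0 : R) 1 g v.
  by rewrite -g'0; apply: derivableP; have [] := sg [::].
pose a := 'D_v ('D_w F) mu.
have cDw : C1 ('D_w F) by apply: smooth_C1; exact: smooth_derive.
pose z r := invmx (Jac F (g r) *m B) *m (Jac F (g r) *m w).
have gc : {for 0, continuous g} by have [_] := sg [::]; exact.
have z0 : z 0 = 0 by rewrite /z g0 Jw mulmx0.
have dJw : is_derive (0 : R) 1 (fun r => Jac F (g r) *m w) a.
  have := is_derive_comp_curve cDw dg; rewrite g0 -derive_Jac //.
  by under eq_fun do rewrite derive_Jac //.
(* No inverse is differentiated: [z] and [Jac F (g r) *m w] vanish at [0] and differ by an
   arbitrarily small fraction of [|z|], so they share their derivative. *)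
have dz : is_derive (0 : R) 1 z a.
  apply: is_derive_eps => e e0.
  have a0 : 0 < 2 * (`|a| + 1) by rewrite mulr_gt0 // ltr_wpDl.
  pose e1 := Num.min 2^-1 (e / 2 / (2 * (`|a| + 1))).
  have e10 : 0 < e1 by rewrite lt_min invr_gt0 ltr0n !divr_gt0.
  have e12 : e1 <= 2^-1 by rewrite ge_min lexx.
  have [d1 d10 H1] := tangent_lift e10 e12.
  pose e2 := Num.min 1 (e / 2).
  have e20 : 0 < e2 by rewrite lt_min ltr01 divr_gt0.
  have [d2 d20 H2] := is_derive_eps_delta dJw e20.
  have [d3 d30 H3] := cvg_eps_delta gc d10.
  exists (Num.min d2 d3); first by rewrite lt_min d20.
  move=> h; rewrite le_min => /andP[h2 h3].
  rewrite [0 + h *: 1]add0r [h *: 1]mulr1 z0 subr0.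
  have := H3 h; rewrite subr0 g0 => /(_ h3) gd.
  have [_ zJ zb] := H1 (g h) (gM h) gd w.
  have := H2 h h2; rewrite [0 + h *: 1]add0r [h *: 1]mulr1 g0 Jw subr0 => Jh.
  have Jn : `|Jac F (g h) *m w| <= (`|a| + 1) * `|h|.
    rewrite -(subrK (h *: a) (Jac F (g h) *m w)).
    apply: le_trans (ler_normD _ _) _; rewrite normrZ mulrDl addrC mulrC lerD // mul1r.
    apply: le_trans Jh _; rewrite ler_piMl //.
    by rewrite ge_min lexx.
  rewrite -(subrKA (Jac F (g h) *m w)); apply: le_trans (ler_normD _ _) _.
  rewrite [e]splitr mulrDl lerD //; last first.
    by apply: le_trans Jh _; rewrite ler_wpM2r // ge_min lexx orbT.
  apply: le_trans zJ _.
  apply: (@le_trans _ _ (e1 * (2 * ((`|a| + 1) * `|h|)))).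
    by rewrite ler_wpM2l ?(ltW e10) // (le_trans zb) // ler_wpM2l.
  rewrite !mulrA ler_wpM2r // -mulrA -ler_pdivlMr //.
  by rewrite ge_min lexx orbT.
have dBz := is_derive_mulmx B dz.
have dnu := is_derive_comp_curve cnu dg.
have d1 := is_derive_dotv dnu (is_derive_cst w (0 : R) 1).
have d2 := is_derive_dotv dnu dBz.
(* Orthogonality makes the products of [nu] with [w] and with [B z] equal near [0]; the derivative
   computed for the latter is transferred to the former. *)
have d12 : is_derive (0 : R) 1 (fun r => dotv (nu (g r)) (cst w r))
    (dotv (Jac nu (g 0) *m v) (B *m z 0) + dotv (nu (g 0)) (B *m a)).
  apply: near_eq_is_derive d2.
  have [d dp H] := @tangent_lift 2^-1 (ltac:(by rewrite invr_gt0)) (lexx _).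
  have [d3 d30 H3] := cvg_eps_delta gc dp.
  apply/nbhs_ballP; exists d3 => //= r; rewrite -ball_normE /= distrC => rd.
  have gr : `|g r - mu| <= d by rewrite -g0; apply: H3; exact: ltW.
  have [Tz _ _] := H (g r) (gM r) gr w.
  have /eqP := Nnu.2 _ (gM r) _ Tz.
  by rewrite dotvBr subr_eq0 => /eqP.
have := @derive_val _ _ _ _ _ _ _ d1; rewrite (@derive_val _ _ _ _ _ _ _ d12).
rewrite g0 z0 mulmx0 -/A => E.
have d00 (x : 'cV[R]_s) : dotv x 0 = 0 by rewrite /dotv mulmx0 mxE.
by move: E; rewrite !d00 add0r addr0.
Qed.

Lemma shape_symmetric : (1%:M + P *m A *m P)^T = 1%:M + P *m A *m P.
Proof.
rewrite linearD /= trmx1; congr (_ + _).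
have sym (v w : 'cV[R]_s) : P *m v = v -> P *m w = w -> dotv (A *m v) w = dotv (A *m w) v.
  move=> Pv Pw; rewrite (normal_derive_tangent Pv Pw) (normal_derive_tangent Pw Pv).
  suff E : 'D_v ('D_w F) mu = 'D_w ('D_v F) mu.
    exact: (congr1 (fun z => dotv (nu mu) (B *m z)) E).
  have dD (u x u' : 'cV[R]_s) : derivable ('D_u F) x u'.
    by have [+ _] := sF [:: u]; apply.
  have E (u : 'cV[R]_s) i : (fun y => 'D_u F y i 0) = 'D_u (fun y => F y i 0).
    by apply/funext => y; rewrite derive_coord //; exact: cF.1.
  apply/colP => i.
  have L u u' : ('D_u ('D_u' F) mu) i 0 = 'D_u ('D_u' (fun y => F y i 0)) mu.
    exact: (etrans (derive_coord i 0 (dD u' mu u)) (congr1 (fun f => 'D_u f mu) (E u' i))).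
  apply: etrans (L v w) _; apply: etrans _ (esym (L w v)).
  by apply: derive_symmetric; exact: smooth_coord.
have Pd j : P *m (P *m delta_mx j 0 : 'cV[R]_s) = P *m delta_mx j 0 by rewrite mulmxA PP.
have ent (X : 'M[R]_s) i j : X i j = dotv (X *m delta_mx j 0) (delta_mx i 0).
  by rewrite -colE dotvC dotv_delta mxE.
apply/matrixP => i j; rewrite mxE !ent.
rewrite -!mulmxA !(dotv_mulmxl P) Pt.
exact: sym.
Qed.

End Chart.

(** Each direction on [R] is a scalar, so an iterated derivative is a constant times an iterated
    derivative of [f] along [u]. *)
Lemma smooth_line (R : realType) (V W : normedModType R) (f : V -> W) (x u : V) :
  smooth f -> smooth (fun r : R => f (x + r *: u)).
Proof.
move=> sf.
have dl c n (r v : R) : is_derive r v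
    (fun a : R => c *: iter_deriv f (nseq n u) (x + a *: u))
    (c *: (v *: iter_deriv f (nseq n.+1 u) (x + r *: u))).
  apply: is_deriveZ; apply: is_derive_dir; apply: derive_line.
  by have [+ _] := sf (nseq n u); apply.
have E vs : exists c : R, iter_deriv (fun r : R => f (x + r *: u)) vs =
    (fun r => c *: iter_deriv f (nseq (size vs) u) (x + r *: u)).
  elim: vs => [|v vs [c IH]]; first by exists 1; apply/funext => r; rewrite scale1r.
  exists (c * v); apply/funext => r; rewrite -scalerA.
  rewrite -[RHS](@derive_val _ _ _ _ _ _ _ (dl c (size vs) r v)).
  by rewrite [LHS]/= IH.
move=> vs; have [c ->] := E vs; split=> [v r|r]; first by have [] := dl c (size vs) r v.
apply: differentiable_continuous; apply/derivable1_diffP.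
by have [] := dl c (size vs) r 1.
Qed.

(** * The Hessian of the squared distance and invertibility of [G] *)

Section Hessian.
Context {R : realType} {s : nat}.
Variables (M : set 'cV[R]_s) (t mu : 'cV[R]_s) (nu : 'cV[R]_s -> 'cV[R]_s).
Hypothesis Nnu : normal_field M nu.
Hypothesis nut : nu mu = t - mu.

(** The second derivative of the surface [sg] enters only through its product with [mu - t].
    Differentiating the orthogonality of [nu (sg z)] to the tangent vector ['D_(e2 1) sg z] trades
    that product for the shape form. *)
Lemma hessian_formula v w h : hessian_at M t mu v w h ->
  h = 2 * (dotv v w + dotv (Jac nu mu *m v) w).
Proof.
move=> [sg [[ssg Msg sg0 [dv dw]] ->]].
have dsg (z u : 'cV[R]_2) : is_derive z u (fun z => sg z - t) ('D_u sg z).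
  rewrite -[X in is_derive _ _ _ X]subr0; apply: is_deriveB.
  by apply: derivableP; have [] := ssg [::].
have -> : 'D_(e2 1) (fun z => dotv (sg z - t) (sg z - t)) =
    (fun z => dotv ('D_(e2 1) sg z) (sg z - t) + dotv (sg z - t) ('D_(e2 1) sg z)).
  apply/funext => z.
  exact: (@derive_val _ _ _ _ _ _ _ (is_derive_dotv (dsg z _) (dsg z _))).
pose DD := 'D_(e2 0) ('D_(e2 1) sg) 0.
have dD : is_derive 0 (e2 0) ('D_(e2 1) sg) DD.
  by apply: derivableP; have [+ _] := ssg [:: e2 1]; apply.
have T z : tangent_space M (sg z) ('D_(e2 1) sg z).
  exists (fun r : R => sg (z + r *: e2 1)); split=> //.
  - exact: smooth_line.
  - by rewrite scale0r addr0.
  have := @derive_line _ _ _ sg z (e2 1) 0.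
  rewrite scale0r addr0 => H.
  apply: (@derive_val _ _ _ _ _ _ _ (H _)).
  by have [] := ssg [::].
have dsg0 : is_derive 0 (e2 0) sg v.
  by rewrite -dv; apply: derivableP; have [] := ssg [::].
have dN := is_derive_dotv (is_derive_comp_curve (smooth_C1 Nnu.1) dsg0) dD.
have N0 : dotv (Jac nu mu *m v) w + dotv (t - mu) DD = 0.
  have := @derive_val _ _ _ _ _ _ _ dN.
  have -> : (fun y => dotv (nu (sg y)) ('D_(e2 1) sg y)) = cst 0.
    by apply/funext => z; exact: Nnu.2 _ (Msg z) _ (T z).
  by rewrite derive_cst sg0 dw nut.
have d1 := is_derive_dotv (dsg 0 (e2 0)) dD.
have d2 := is_derive_dotv dD (dsg 0 (e2 0)).
rewrite (@derive_val _ _ _ _ _ _ _ (is_deriveD d2 d1)) sg0 dv dw.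
have -> : dotv (mu - t) DD = dotv (Jac nu mu *m v) w.
  by move/eqP: N0; rewrite addr_eq0 -dotvNl opprB => /eqP.
by rewrite (dotvC DD) (dotvC w) -[mu - t]opprB dotvNl; move/eqP: N0; rewrite addr_eq0 => /eqP ->; ring.
Qed.

Variable P : 'M[R]_s.
Hypothesis HP : is_tan_proj M mu P.

Lemma shape_mxE : mx_of (fun x => x - weingarten P nu mu (P *m x)) =
  1%:M + P *m Jac nu mu *m P.
Proof.
apply/matrixP => i j; rewrite mxE /weingarten opprK.
rewrite (derive_Jac (smooth_C1 Nnu.1)) !mulmxA -colE [LHS]mxE [in RHS]mxE.
by congr (_ + _); rewrite ?mxE // eqxx andbT.
Qed.

(** A kernel vector satisfies [x = - P A P x] (with [A = Jac nu mu]), so it is tangent; then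
    [hessian_formula] makes all Hessian values at [x] zero. *)
Lemma shape_unitmx : hessian_nondeg M t mu ->
  1%:M + P *m Jac nu mu *m P \in unitmx.
Proof.
move=> nondeg; have [Pt PP PT] := HP.
apply: inj_unitmx => x; rewrite mulmxDl mul1mx => /eqP.
rewrite addr_eq0 -!mulmxA => /eqP E.
have Px : P *m x = x by rewrite {1}E mulmxN (mulmxA P P) PP -E.
apply: (nondeg x); first exact/PT.
move=> w h /PT Pw /hessian_formula ->.
have -> : dotv (Jac nu mu *m x) w = dotv (P *m (Jac nu mu *m (P *m x))) w.
  by rewrite Px (dotv_mulmxl P) Pt Pw.
by rewrite -dotvDl {1}E addNr /dotv trmx0 mul0mx mxE mulr0.
Qed.

End Hessian.

Lemma linearization_arith (R : realType) (c c' e1 e a b g : R) :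
  0 <= c -> 0 <= c' -> 0 <= e1 -> e1 <= 1 -> e1 * (c + 1) <= 2^-1 ->
  e1 * (2 * (c * (c' + 1)) + 1) <= e ->
  a <= c * g -> g <= c' * b + e1 * (b + a) -> 0 <= b -> 0 <= a ->
  e1 * (b + a) <= e * b.
Proof.
move=> c0 c'0 e10 e1a e1b e1c ag gb b0 a0.
have a1 : a <= c * (c' + 1) * b + 2^-1 * a.
  apply: le_trans ag (le_trans (ler_wpM2l c0 gb) _).
  have : c * (e1 * b) <= c * b by rewrite ler_wpM2l // ler_piMl.
  have : (c * e1) * a <= 2^-1 * a by rewrite ler_wpM2r //; nra.
  lra.
have a2 : a <= 2 * (c * (c' + 1)) * b by lra.
apply: (@le_trans _ _ (e1 * (2 * (c * (c' + 1)) + 1) * b)); last by rewrite ler_wpM2r.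
by rewrite -mulrA ler_wpM2l //; lra.
Qed.

Lemma nearest_linearization (R : realType) (s m : nat) (M : set 'cV[R]_s)
    (t mu : 'cV[R]_s) (P : 'M[R]_s) (nu : 'cV[R]_s -> 'cV[R]_s) :
  submanifold m M -> compact M -> ~ cutlocus M t -> nearest M t mu ->
  is_tan_proj M mu P -> normal_field M nu -> nu mu = t - mu ->
  let G := mx_of (fun x => x - weingarten P nu mu (P *m x)) in
  [/\ \rank P = m, G^T = G,
    forall e : R, 0 < e -> exists2 d : R, 0 < d & forall x mu',
      `|x - t| <= d -> nearest M x mu' -> `|mu' - mu| <= e &
    forall e : R, 0 < e -> exists2 d : R, 0 < d & forall x mu',
      `|x - t| <= d -> nearest M x mu' ->
      `|G *m (mu' - mu) - P *m (x - t)| <= e * `|x - t|].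
Proof.
move=> [ms HM] cM /contrapT [[mu0 [_ uniq0]] Hnd] nmu HP Nnu nut G.
have [Mmu _] := nmu.
have uniq mu' : nearest M t mu' -> mu' = mu.
  by move=> n'; rewrite -(uniq0 _ n') (uniq0 _ nmu).
have [U [F [oU Umu sF UM surj]]] := HM mu Mmu.
have [B JB] := Jac_surj_right_inverse (smooth_C1 sF) (surj mu Umu Mmu).
have cons := nearest_continuous cM uniq nmu.
have GE : G = 1%:M + P *m Jac nu mu *m P by exact: (shape_mxE _ Nnu).
have Gu : G \in unitmx by rewrite GE; exact: (shape_unitmx Nnu nut HP (Hnd _ nmu)).
split=> //.
- by rewrite (tan_proj_rank oU sF UM Umu Mmu JB HP) subKn.
- by rewrite GE (shape_symmetric oU sF UM Umu Mmu JB HP Nnu).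
move=> e e0.
pose c := s%:R * `|invmx G|.
pose c' := s%:R * `|P|.
have c0 : 0 <= c by rewrite mulr_ge0.
have c'0 : 0 <= c' by rewrite mulr_ge0.
pose C := 2 * (c * (c' + 1)).
have C0 : 0 <= C by rewrite !mulr_ge0 // addr_ge0.
have c10 : 0 < c + 1 by rewrite ltr_wpDl.
have C10 : 0 < C + 1 by rewrite ltr_wpDl.
(* The middle bound absorbs [|u|] on the right of its own estimate, giving [|u| <= C |h|]; the last
   one then turns [e1 (|h| + |u|)] into [e |h|]. *)
pose e1 := Num.min 1 (Num.min (2^-1 / (c + 1)) (e / (C + 1))).
have e10 : 0 < e1 by rewrite !lt_min ltr01 !divr_gt0 ?invr_gt0.
have e1a : e1 <= 1 by rewrite !ge_min lexx.
have e1b : e1 * (c + 1) <= 2^-1 by rewrite -ler_pdivlMr // !ge_min lexx !orbT.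
have e1c : e1 * (C + 1) <= e by rewrite -ler_pdivlMr // !ge_min lexx !orbT.
have [d1 d10 H1] := nearest_expansion oU sF UM Umu Mmu JB HP Nnu nut e10.
have [d2 d20 H2] := cons d1 d10.
exists d2 => // x mu' xt nx.
have := H1 x mu' (H2 _ _ xt nx) nx; rewrite -GE.
set u := mu' - mu; set h := x - t => Gh.
have un : `|u| <= c * `|G *m u| by rewrite -{1}(mulKmx Gu u) mulmx_norm.
have Gn : `|G *m u| <= c' * `|h| + e1 * (`|h| + `|u|).
  rewrite -(subrK (P *m h) (G *m u)) addrC; apply: le_trans (ler_normD _ _) _.
  by rewrite lerD // mulmx_norm.
apply: le_trans Gh _.
move: un Gn (normr_ge0 h) (normr_ge0 u).
move: (`|u|) (`|h|) (`|G *m u|) => a b g ag gb b0 a0.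
exact: (linearization_arith c0 c'0 (ltW e10) e1a e1b e1c ag gb b0 a0).
Qed.

(** * Convergence in distribution of random vectors *)

Section Continuity.
Context {R : realType}.

Lemma lipschitz_continuous_at (V W : normedModType R) (f : V -> W) (C : R) :
  0 <= C -> (forall x y, `|f x - f y| <= C * `|x - y|) -> continuous f.
Proof.
move=> C0 H x; apply/cvgrPdist_le => e e0.
have C1 : 0 < C + 1 by rewrite ltr_wpDl.
apply/nbhs_ballP; exists (e / (C + 1)); first exact: divr_gt0.
move=> y; rewrite -ball_normE /= => xy; apply: le_trans (H x y) _.
rewrite -(divfK (lt0r_neq0 C1) e) mulrC ler_pM // ?(ltW xy) // lerDl //.
Qed.

Lemma mulmx_continuous m n p (A : 'M[R]_(m, n)) :
  continuous (fun x : 'M[R]_(n, p) => A *m x).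
Proof.
apply: (@lipschitz_continuous_at _ _ _ (n%:R * `|A|)); first by rewrite mulr_ge0.
by move=> x y; rewrite -mulmxBr mulmx_norm.
Qed.

Lemma quadratic_continuous s (A : 'M[R]_s) :
  continuous (fun x : 'cV[R]_s => dotv x (A *m x)).
Proof.
have -> : (fun x : 'cV[R]_s => dotv x (A *m x)) =
    \sum_(i < s) (fun x : 'cV[R]_s => x i 0) *
                 (\sum_(j < s) A i j \*: (fun x : 'cV[R]_s => x j 0)).
  apply/funext => x; rewrite dotvE fct_sumE; apply: eq_bigr => i _.
  by rewrite mxE; congr (_ * _); rewrite fct_sumE.
move=> x; apply: differentiable_continuous; apply: differentiable_sum => i.
apply: differentiableM; first exact: differentiable_coord.
apply: differentiable_sum => j.
by apply: differentiableZ; exact: differentiable_coord.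
Qed.

Lemma dotv_continuous s : continuous (fun x : 'cV[R]_s => dotv x x).
Proof.
have -> : (fun x : 'cV[R]_s => dotv x x) = (fun x => dotv x (1%:M *m x)).
  by apply/funext => x; rewrite mul1mx.
exact: quadratic_continuous.
Qed.

Lemma enorm_continuous s : continuous (@enorm R s).
Proof.
move=> x; apply: (@continuous_comp _ _ _ (fun y : 'cV[R]_s => dotv y y)).
  exact: dotv_continuous.
exact: sqrt_continuous.
Qed.

Lemma closed_ball_compact s (K : R) : compact [set x : 'cV[R]_s | `|x| <= K].
Proof.
have -> : [set x : 'cV[R]_s | `|x| <= K] = trmx @` [set y : 'rV[R]_s | `|y| <= K].
  have nT m n (x : 'M[R]_(m, n)) : `|x^T| <= `|x|.
    by apply: norm_le_coord => // i j; rewrite mxE coord_le_norm.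
  apply/seteqP; split=> [x /= xK|_ [y /= yK <-]] /=; last exact: le_trans (nT _ _ _) yK.
  by exists x^T; [exact: le_trans (nT _ _ _) xK | rewrite trmxK].
apply: continuous_compact.
  apply: continuous_subspaceT.
  apply: (@lipschitz_continuous_at _ _ _ 1) => // x y; rewrite mul1r -linearB /=.
  by apply: norm_le_coord => // i j; rewrite mxE coord_le_norm.
apply: bounded_closed_compact.
  exists K; split; first exact: num_real.
  by move=> r Kr x /= xK; apply: le_trans xK (ltW Kr).
apply: (@preimage_closed _ _ (fun y : 'rV[R]_s => `|y|) [set r | r <= K]).
  by move=> y _; exact: norm_continuous.
exact: closed_le.
Qed.

(** Only [x] is confined to the ball, while [y] may leave it. Compactness is used in its
    near-covering form, with the radius as the parameter tending to [0]. *)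
Lemma ball_uniform_continuity s (f : 'cV[R]_s -> R) (K e : R) : continuous f -> 0 < e ->
  exists2 d : R, 0 < d & forall x y, `|x| <= K -> `|y - x| <= d -> `|f y - f x| <= e.
Proof.
move=> cf e0.
have /compact_near_coveringP H := @closed_ball_compact s K.
have [|d /= d0 Hd] := @H R (nbhs (0 : R))
  (fun d x => forall y, `|y - x| <= `|d| -> `|f y - f x| <= e) _.
  move=> x _.
  have [d d0 Hd] := cvg_eps_delta (cf x) (divr_gt0 e0 (@ltr0Sn R 1)).
  have d2 : 0 < d / 2 by rewrite divr_gt0.
  exists (ball x (d / 2), ball (0 : R) (d / 2)).
    by split; apply: nbhsx_ballx.
  move=> [x' r] /= []; rewrite -!ball_normE /= sub0r normrN => xx' rd y yx'.
  rewrite distrC in xx'.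
  have h1 : `|f x' - f x| <= e / 2.
    by apply: Hd; apply: le_trans (ltW xx') _; rewrite ler_pdivrMr // ler_pMr // ler1n.
  have h2 : `|f y - f x| <= e / 2.
    apply: Hd; rewrite -(subrKA x'); apply: le_trans (ler_normD _ _) _.
    by rewrite [d]splitr lerD // ltW // (le_lt_trans yx').
  rewrite -(subrKA (f x)); apply: le_trans (ler_normD _ _) _.
  by rewrite [e]splitr lerD // distrC.
exists (d / 2); first exact: divr_gt0.
move=> x y xK yx; apply: (Hd (d / 2)) => //.
  rewrite /= sub0r normrN gtr0_norm ?divr_gt0 //.
  by rewrite ltr_pdivrMr // ltr_pMr // ltr1n.
by rewrite gtr0_norm ?divr_gt0.
Qed.

End Continuity.

Section EventuallySmall.
Context {R : realType}.

Lemma cvge0_near (u : nat -> \bar R) : u @ \oo --> 0%E ->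
  forall e : R, 0 < e -> \forall n \near \oo, (u n <= e%:E)%E.
Proof.
move=> /fine_cvgP [fin /cvgrPdist_le H] e e0.
move: fin (H e e0); apply: filterS2 => n fn h.
rewrite -(fineK fn) lee_fin; apply: le_trans (ler_norm _) _.
by move: h; rewrite /= sub0r normrN.
Qed.

Lemma near_cvge0 (u : nat -> \bar R) : (forall n, (0 <= u n)%E) ->
  (forall e : R, 0 < e -> \forall n \near \oo, (u n <= e%:E)%E) -> u @ \oo --> 0%E.
Proof.
move=> u0 H; have fin n e : (u n <= e%:E)%E -> u n \is a fin_num.
  by move=> h; rewrite ge0_fin_numE // (le_lt_trans h) // ltry.
apply/fine_cvgP; split.
  by apply: filterS (H 1 ltr01) => n; exact: fin.
apply/cvgrPdist_le => e e0; apply: filterS (H e e0) => n h /=.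
rewrite sub0r normrN ger0_norm ?fine_ge0 //.
by rewrite -lee_fin fineK //; exact: fin h.
Qed.

End EventuallySmall.

Section RandomVectors.
Context {R : realType} {s : nat} {d : measure_display} {Omega : measurableType d}.
Implicit Types X Y : Omega -> 'cV[R]_s.

(* The open set is a countable union of cubes with rational centres. *)
Lemma measurable_preimage_open X (O : set 'cV[R]_s) :
  rand_vec X -> open O -> measurable (X @^-1` O).
Proof.
move=> mX oO.
pose box (q : 'cV[rat]_s * nat) : set 'cV[R]_s :=
  [set x | forall i, `|x i 0 - ratr (q.1 i 0)| < q.2.+1%:R^-1].
pose F q := if `[< box q `<=` O >] then X @^-1` box q else set0.
have -> : X @^-1` O = \bigcup_q F q.
  apply/seteqP; split=> w /=; last first.
    by move=> [q _]; rewrite /F; case: asboolP => // sub; exact: sub.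
  move=> OX; have /nbhs_ballP [e /= e0 he] : nbhs (X w) O by apply: open_nbhs_nbhs.
  (* Then [1 / (n + 1) < e / 2]: a cube of this radius around a rational point that close to [X w]
     lies in the [e]-ball about [X w]. *)
  pose n := Num.truncn (2 / e).
  have nd : (n.+1%:R^-1 : R) < e / 2.
    rewrite -[e / 2]invrK ltf_pV2 ?posrE ?invr_gt0 ?divr_gt0 //.
    by rewrite invfM invrK mulrC truncnS_gt.
  have ex i : exists r : rat, `|X w i 0 - ratr r| < n.+1%:R^-1.
    have [|r] := @rat_in_itvoo R (X w i 0 - n.+1%:R^-1) (X w i 0 + n.+1%:R^-1).
      by rewrite ltrBlDr -addrA ltrDl addr_gt0 // invr_gt0.
    rewrite in_itv /= => /andP[r1 r2]; exists r.
    by rewrite ltr_distlC ltrBlDr -ltrBlDr r1 /= -ltrBlDr; move: r2; rewrite ltrBlDr.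
  have [g Hg] := choice ex.
  exists (\col_i g i, n) => //; rewrite /F; case: asboolP => [_|].
    by move=> i /=; rewrite mxE.
  case=> y yb; apply: he; rewrite -ball_normE /=.
  apply: (@le_lt_trans _ _ (n.+1%:R^-1 + n.+1%:R^-1)); last by rewrite [e]splitr ltrD.
  apply: norm_le_coord => [|i j]; first by rewrite addr_ge0 ?invr_ge0.
  rewrite ord1 !mxE -(subrKA (ratr (g i))); apply: le_trans (ler_normD _ _) _.
  rewrite lerD ?(ltW (Hg i)) // distrC ltW //.
  by have := yb i; rewrite /= mxE.
apply: countable_bigcupT_measurable; first exact: countableP.
move=> q; rewrite /F; case: ifP => _; last exact: measurable0.
have -> : X @^-1` box q = \bigcap_(i in [set: 'I_s])
    [set w | `|X w i 0 - ratr (q.1 i 0)| < q.2.+1%:R^-1].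
  by apply/seteqP; split=> [w h i _|w h i]; [exact: h | exact: (h i I)].
apply: fin_bigcap_measurable; first exact: finite_finset.
move=> i _.
have m : measurable_fun setT (fun w => `|X w i 0 - ratr (q.1 i 0)|).
  by apply: measurableT_comp => //; apply: measurable_funB => //; exact: mX.
have := m measurableT _ (@measurable_itv R `]-oo, q.2.+1%:R^-1[).
by rewrite setTI; congr (measurable _).
Qed.

Lemma measurable_comp_continuous X (f : 'cV[R]_s -> R) :
  rand_vec X -> continuous f -> measurable_fun setT (fun w => f (X w)).
Proof.
move=> mX cf; apply: (measurability _ (RGenOInfty.measurableE R)).
move=> _ [_ [a ->] <-]; rewrite setTI.
apply: (@measurable_preimage_open X (f @^-1` `]a, +oo[%classic)) => //.
by move/continuousP : cf; apply; exact: rray_open.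
Qed.

Lemma rand_vec_comp X (f : 'cV[R]_s -> 'cV[R]_s) :
  rand_vec X -> continuous f -> rand_vec (fun w => f (X w)).
Proof.
move=> mX cf i j; apply: (@measurable_comp_continuous X (fun x => f x i j)) => // x.
exact: (@continuous_coord _ _ _ _ f i j x (cf x)).
Qed.

Lemma measurable_ge (f : Omega -> R) (e : R) :
  measurable_fun setT f -> measurable [set w | e <= f w].
Proof.
move=> mf; have := mf measurableT _ (@measurable_itv R `[e, +oo[).
rewrite setTI; congr (measurable _).
by apply/seteqP; split=> w /=; rewrite in_itv /= andbT.
Qed.

Variable P : probability Omega R.

Lemma bounded_integrable (f : Omega -> R) (C : R) :
  measurable_fun setT f -> (forall w, `|f w| <= C) -> P.-integrable setT (EFin \o f).
Proof.
move=> mf bf; apply: measurable_bounded_integrable => //.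
  exact: le_lt_trans (probability_le1 P measurableT) (ltry 1).
by exists C; split; [exact: num_real | move=> r Cr w _ /=; exact: le_trans (bf w) (ltW Cr)].
Qed.

Lemma bounded_integralE (f : Omega -> R) (C : R) :
  measurable_fun setT f -> (forall w, `|f w| <= C) ->
  (\int[P]_w (f w)%:E)%E = (\int[P]_w f w)%:E.
Proof.
by move=> mf bf; rewrite /Rintegral fineK //; exact: integrable_fin_num (bounded_integrable mf bf).
Qed.

Lemma measure_le_near (A B : nat -> set Omega) (e : \bar R) :
  (forall n, measurable (A n)) -> (forall n, measurable (B n)) ->
  (\forall n \near \oo, A n `<=` B n) -> (\forall n \near \oo, (P (B n) <= e)%E) ->
  \forall n \near \oo, (P (A n) <= e)%E.
Proof.
move=> mA mB; apply: filterS2 => n AB; apply: le_trans.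
by apply: le_measure; rewrite ?inE.
Qed.

End RandomVectors.

Lemma clamp_lipschitz (R : realType) (a b c : R) :
  `|Num.min 1 (Num.max 0 (a - c)) - Num.min 1 (Num.max 0 (b - c))| <= `|a - b|.
Proof.
wlog ab : a b / a <= b => [H|].
  by have [/H//|/ltW /H] := leP a b; rewrite distrC (distrC b).
rewrite ler_norml [`|a - b|]distrC (ger0_norm (_ : 0 <= b - a)) ?subr_ge0 //.
have [h1|h1] := leP (a - c) 0; have [h2|h2] := leP (b - c) 0;
  rewrite ?(min_r ler01) /Num.min; do ?case: ifP => ?; apply/andP; split; lra.
Qed.

Section ConvergenceInDistribution.
Context {R : realType} {s : nat}.
Context {d : measure_display} {Omega : measurableType d} (P : probability Omega R).
Context {d' : measure_display} {Omega' : measurableType d'} (P' : probability Omega' R).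
Variables (X : nat -> Omega -> 'cV[R]_s) (Y : Omega' -> 'cV[R]_s).
Hypothesis mX : forall n, rand_vec (X n).
Hypothesis mY : rand_vec Y.

Lemma cvg_dist_Rintegral (f : 'cV[R]_s -> R) (C : R) :
  continuous f -> (forall x, `|f x| <= C) -> cvg_dist P P' X Y ->
  (\int[P]_w f (X n w)) @[n --> \oo] --> \int[P']_w f (Y w).
Proof.
move=> cf bf /(_ f cf (ex_intro _ C bf)).
rewrite (bounded_integralE P' (measurable_comp_continuous mY cf) (fun w => bf _)).
by move=> /fine_cvgP [_].
Qed.

(** The continuous function [f] lies between the indicators of [|x| >= k + 1] and [|x| >= k], so the
    tail of the single vector [Y] controls those of almost all [X n]. *)
Lemma cvg_dist_tight : cvg_dist P P' X Y -> forall e : R, 0 < e ->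
  exists2 K : R, 0 < K &
    \forall n \near \oo, (P [set w | (K <= `|X n w|)%R] <= e%:E)%E.
Proof.
move=> XY e e0; have e2 : 0 < e / 2 by rewrite divr_gt0.
have mnY : measurable_fun setT (fun w => `|Y w|).
  by apply: measurable_comp_continuous => //; exact: norm_continuous.
pose F (k : nat) := [set w | k%:R <= `|Y w|].
have mF k : measurable (F k) by exact: measurable_ge.
have F0 : \bigcap_k F k = set0.
  apply/seteqP; split=> // w /(_ (Num.truncn `|Y w|).+1 I).
  by rewrite /F /= leNgt truncnS_gt.
have [k Fk] : exists k, (P' (F k) <= (e / 2)%:E)%E.
  have : (P' \o F) @ \oo --> P' (\bigcap_k F k).
    apply: nonincreasing_cvg_mu => //.
    - by rewrite (le_lt_trans (probability_le1 P' (mF 0%N))) // ltry.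
    - by rewrite F0; exact: measurable0.
    - move=> i j ij; apply/subsetPset => w; rewrite /F /=; apply: le_trans.
      by rewrite ler_nat.
  rewrite F0 measure0 => /cvge0_near /(_ _ e2) [n _ Hn].
  by exists n; exact: (Hn n (leqnn n)).
pose f (x : 'cV[R]_s) := Num.min 1 (Num.max 0 (`|x| - k%:R)).
have f0 x : 0 <= f x by rewrite /f le_min ler01 le_max lexx.
have f1 x : f x <= 1 by rewrite /f ge_min lexx.
have bf x : `|f x| <= 1 by rewrite ger0_norm.
have cf : continuous f.
  apply: (@lipschitz_continuous_at _ _ _ _ 1) => // x y; rewrite mul1r.
  by apply: le_trans (ler_dist_dist x y); exact: clamp_lipschitz.
have mfX n : measurable_fun setT (fun w => f (X n w)) by exact: measurable_comp_continuous.
have mfY : measurable_fun setT (fun w => f (Y w)) by exact: measurable_comp_continuous.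
have IY : (\int[P']_w (f (Y w))%:E <= (e / 2)%:E)%E.
  apply: le_trans _ Fk.
  have -> : P' (F k) = (\int[P']_w (\1_(F k) w)%:E)%E by rewrite integral_indic // setIT.
  apply: ge0_le_integral => //.
  - by move=> w _; rewrite lee_fin.
  - exact/measurable_EFinP.
  - by apply/measurable_EFinP; exact: measurable_indic.
  move=> w _; rewrite lee_fin indicE; have [h|h] := boolP (w \in F k) => //=.
  rewrite /f ge_min; apply/orP; right; rewrite ge_max lexx /= subr_le0 ltW //.
  by move: h; rewrite notin_setE /F /= => /negP; rewrite -ltNge.
have := cvg_dist_Rintegral cf bf XY => /cvgrPdist_le /(_ _ e2) H.
exists (k%:R + 1); first by rewrite ltr_wpDl.
apply: filterS H => n H.
have mA : measurable [set w | (k%:R + 1 <= `|X n w|)%R].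
  apply: measurable_ge; apply: measurable_comp_continuous => //.
  exact: norm_continuous.
apply: (@le_trans _ _ (\int[P]_w (f (X n w))%:E)%E).
  have -> : P [set w | (k%:R + 1 <= `|X n w|)%R] =
    (\int[P]_w (\1_[set w | (k%:R + 1 <= `|X n w|)%R] w)%:E)%E.
    by rewrite integral_indic // setIT.
  apply: ge0_le_integral => //.
  - by apply/measurable_EFinP; exact: measurable_indic.
  - exact/measurable_EFinP.
  move=> w _; rewrite lee_fin indicE; case: (boolP (w \in _)) => //=.
  rewrite inE /= => h; rewrite /f le_min lexx /= le_max; apply/orP; right.
  by rewrite lerBrDl.
rewrite (bounded_integralE P (mfX n) (fun w => bf _)) lee_fin.
move: IY; rewrite (bounded_integralE P' mfY (fun w => bf _)) lee_fin.
by move: H; rewrite ler_norml => /andP[]; lra.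
Qed.

(** A continuous test function need not be uniformly continuous, so tightness first confines [X n]
    to a ball. Outside the bad event [B] the integrands then differ by at most [e / 2], on [B] by at
    most [2 C]. *)
Lemma cvg_dist_slutsky (A : 'M[R]_s) (L : nat -> Omega -> 'cV[R]_s) :
  (forall n, rand_vec (L n)) -> cvg_dist P P' X Y ->
  cvg_prob0 P (fun n w => enorm (L n w - A *m X n w)) ->
  cvg_dist P P' L (fun w => A *m Y w).
Proof.
move=> mL XY LX f cf [C bf].
have cfA : continuous (fun x => f (A *m x)).
  by move=> x; apply: continuous_comp; [exact: mulmx_continuous | exact: cf].
have mfY : measurable_fun setT (fun w => f (A *m Y w)).
  exact: (measurable_comp_continuous mY cfA).
have mfX n : measurable_fun setT (fun w => f (A *m X n w)).
  exact: (measurable_comp_continuous (mX n) cfA).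
have mfL n : measurable_fun setT (fun w => f (L n w)).
  exact: (measurable_comp_continuous (mL n) cf).
have C0 : 0 <= C by apply: le_trans (bf 0).
rewrite (bounded_integralE P' mfY (fun w => bf _)).
rewrite (_ : (fun n => _) = (fun n => (\int[P]_w f (L n w))%:E)); last first.
  by apply/funext => n; exact: (bounded_integralE P (mfL n) (fun w => bf _)).
apply: cvg_EFin; first by near=> n.
have XYA := cvg_dist_Rintegral cfA (fun x => bf _) XY.
suff D0 : (\int[P]_w f (L n w) - \int[P]_w f (A *m X n w)) @[n --> \oo] --> (0 : R).
  rewrite (_ : fine \o _ = (fun n => \int[P]_w f (L n w) - \int[P]_w f (A *m X n w) +
    \int[P]_w f (A *m X n w))); last by apply/funext => n; rewrite /= subrK.
  by rewrite -[X in _ --> X]add0r; exact: cvgD D0 XYA.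
apply/cvgrPdist_le => e e0.
have C4 : 0 < 4 * C + 1 by rewrite ltr_wpDl // mulr_ge0.
(* The bad event has probability at most [2 e1] and costs [2 C] there, which is at most [e / 2] in
   all. *)
pose e1 := e / 2 / (4 * C + 1).
have e10 : 0 < e1 by rewrite !divr_gt0.
have [K K0 tight] := cvg_dist_tight XY e10.
have [dl dl0 unif] := @ball_uniform_continuity _ _ f (s%:R * `|A| * K) _ cf (divr_gt0 e0 (@ltr0Sn R 1)).
pose B1 n := [set w | (dl <= `|enorm (L n w - A *m X n w)|)%R].
pose B2 n := [set w | (K <= `|X n w|)%R].
have mB2 n : measurable (B2 n).
  by apply: measurable_ge; apply: measurable_comp_continuous => //; exact: norm_continuous.
have mB1 n : measurable (B1 n).
  apply: measurable_ge; apply: measurableT_comp => //.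
  apply: (@measurable_comp_continuous _ _ _ _ (fun w => L n w - A *m X n w)).
    move=> i j; under eq_fun do rewrite mxE [X in _ + X]mxE.
    apply: measurable_funB; first exact: mL.
    have := @rand_vec_comp _ _ _ _ (X n) (mulmx A) (mX n); apply.
    exact: mulmx_continuous.
  exact: enorm_continuous.
have near1 := cvge0_near (LX dl dl0) e10.
move: tight near1; apply: filterS2 => n PB2 PB1.
pose B := B1 n `|` B2 n.
have mB : measurable B by exact: measurableU.
have PB : fine (P B) <= e1 + e1.
  have fB : P B \is a fin_num by rewrite fin_num_measure.
  rewrite -lee_fin fineK // EFinD; apply: le_trans (measureU2 _ _ _) _ => //.
  exact: leeD.
rewrite /= sub0r normrN -RintegralB //; last 2 first.
- exact: bounded_integrable (mfL n) (fun w => bf _).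
- exact: bounded_integrable (mfX n) (fun w => bf _).
have mD : measurable_fun setT (fun w => f (L n w) - f (A *m X n w)).
  exact: measurable_funB.
have bD w : `|f (L n w) - f (A *m X n w)| <= C + C.
  by apply: le_trans (ler_normB _ _) _; rewrite lerD.
apply: le_trans (le_normr_Rintegral _ (bounded_integrable P mD bD)) _ => //.
have mI : measurable_fun setT (\1_B : Omega -> R) by exact: measurable_indic.
have bI w : `|\1_B w| <= 1 :> R.
  by rewrite indicE; case: (w \in B); rewrite ?normr1 ?normr0.
have iI := bounded_integrable P mI bI.
have i2 : P.-integrable setT (EFin \o (fun w => (C + C) * \1_B w)).
  apply: (@bounded_integrable _ _ _ _ _ (C + C)).
    by apply: measurable_funM => //; exact: measurable_cst.
  by move=> w; rewrite normrM ger0_norm ?addr_ge0 // ler_piMr // addr_ge0.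
have i1 : P.-integrable setT (EFin \o (fun=> e / 2)).
  by apply: (@bounded_integrable _ _ _ _ _ `|e / 2|) => //; exact: measurable_cst.
apply: (@le_trans _ _ (\int[P]_w (e / 2 + (C + C) * \1_B w))).
  apply: le_Rintegral => //.
  - apply: (@bounded_integrable _ _ _ _ _ (C + C)).
      exact: measurableT_comp.
    by move=> w; rewrite normr_id.
  - apply: (@bounded_integrable _ _ _ _ _ (`|e / 2| + (C + C))).
      apply: measurable_funD; first exact: measurable_cst.
      by apply: measurable_funM => //; exact: measurable_cst.
    move=> w; apply: le_trans (ler_normD _ _) _; rewrite lerD2l.
    by rewrite normrM ger0_norm ?addr_ge0 // ler_piMr // addr_ge0.
  move=> w _; rewrite indicE; have [h|h] := boolP (w \in B).
    rewrite mulr1; apply: le_trans (bD w) _; rewrite lerDr divr_ge0 // ltW //.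
  rewrite mulr0 addr0.
  move: h; rewrite notin_setE => /not_orP [/negP h1 /negP h2].
  rewrite -ltNge in h1; rewrite -ltNge in h2.
  apply: unif.
    apply: le_trans (mulmx_norm _ _) _; rewrite ler_wpM2l ?mulr_ge0 //.
    exact: ltW.
  apply: le_trans (norm_le_enorm _) _; apply: le_trans (ler_norm _) _.
  exact: ltW.
rewrite RintegralD // Rintegral_cst // RintegralZl //.
have -> : \int[P]_w \1_B w = fine (P B).
  by rewrite /Rintegral integral_indic // setIT.
rewrite (_ : fine _ = 1); last exact: (congr1 fine (probability_setT P)).
rewrite mulr1 [leRHS]splitr lerD2l.
apply: le_trans (ler_wpM2l _ PB) _; first by rewrite addr_ge0.
have -> : (C + C) * (e1 + e1) = e / 2 * (4 * C / (4 * C + 1)).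
  by rewrite /e1; field; rewrite lt0r_neq0.
rewrite ler_piMr //; first by rewrite divr_ge0 // ltW.
by rewrite ler_pdivrMr // mul1r lerDl.
Unshelve. all: by end_near. Qed.

End ConvergenceInDistribution.

Section Spherical.
Context {R : realType} {s : nat}.
Context {d : measure_display} {Omega : measurableType d} (P : probability Omega R).

Lemma borel_preimage (f : 'cV[R]_s -> R) (B : set R) :
  continuous f -> measurable B -> borel (f @^-1` B).
Proof.
move=> cf mB.
have mf : measurable_fun setT (f : g_sigma_algebraType (@open 'cV[R]_s) -> R).
  apply: (measurability _ (RGenOInfty.measurableE R)).
  move=> _ [_ [a ->] <-]; rewrite setTI; apply: sub_sigma_algebra.
  by move/continuousP : cf; apply; exact: rray_open.
by have := mf measurableT B mB; rewrite setTI.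
Qed.

(** Both integrals are integrals of the identity on [R] against the laws of [f (H Z)] and [f (Z)];
    these laws agree because preimages of measurable sets under [f] are Borel. *)
Lemma spherical_integral (Z : Omega -> 'cV[R]_s) (H : 'M[R]_s) (f : 'cV[R]_s -> R) (C : R) :
  rand_vec Z -> spherical P Z -> H^T *m H = 1%:M -> continuous f ->
  (forall x, `|f x| <= C) ->
  (\int[P]_w (f (H *m Z w))%:E = \int[P]_w (f (Z w))%:E)%E.
Proof.
move=> mZ sZ HH cf bf.
have cfH : continuous (fun x => f (H *m x)).
  by move=> x; apply: continuous_comp; [exact: mulmx_continuous | exact: cf].
have m1 : measurable_fun setT (fun w => f (H *m Z w)).
  exact: (measurable_comp_continuous mZ cfH).
have m2 : measurable_fun setT (fun w => f (Z w)).
  exact: (measurable_comp_continuous mZ cf).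
have E (g : Omega -> R) : measurable_fun setT g -> (forall w, `|g w| <= C) ->
    (\int[P]_w (g w)%:E = \int[pushforward P g]_y y%:E)%E.
  move=> mg bg; rewrite integral_pushforward //.
  exact: bounded_integrable mg bg.
rewrite (E _ m1) // (E _ m2) //; apply: eq_measure_integral => B mB _.
by rewrite /pushforward; have := sZ H HH _ (borel_preimage cf mB).
Qed.

End Spherical.

(** * The limit theorem *)

(** The event that [Y n] is large is eventually contained in the event [|X n| >= K], whose
    probability tightness bounds. *)
Lemma cvg_prob0_tight (R : realType) s d (Omega : measurableType d)
    (P : probability Omega R) (X : nat -> Omega -> 'cV[R]_s) (Y : nat -> Omega -> R) :
  (forall n, rand_vec (X n)) -> (forall n, measurable_fun setT (Y n)) ->
  (forall e : R, 0 < e -> exists2 K : R, 0 < K &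
    \forall n \near \oo, (P [set w | (K <= `|X n w|)%R] <= e%:E)%E) ->
  (forall K eps : R, 0 < K -> 0 < eps ->
    \forall n \near \oo, forall w, `|X n w| < K -> `|Y n w| < eps) ->
  cvg_prob0 P Y.
Proof.
move=> mX mY tight H eps eps0; apply: near_cvge0 => [n|e e0]; first exact: measure_ge0.
have [K K0 HK] := tight e e0.
apply: measure_le_near HK.
- by move=> n; apply: measurable_ge; exact: measurableT_comp.
- move=> n; apply: measurable_ge; apply: measurable_comp_continuous => //.
  exact: norm_continuous.
apply: filterS (H K eps K0 eps0) => n Hn w /= Yw; rewrite leNgt; apply/negP => /Hn.
by rewrite ltNge Yw.
Qed.

Lemma affine_continuous (R : realType) s (c : R) (B : 'M[R]_s) (t : 'cV[R]_s) :
  continuous (fun x : 'cV[R]_s => c *: (B *m (x - t))).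
Proof.
apply: (@lipschitz_continuous_at _ _ _ _ (`|c| * (s%:R * `|B|))).
  by rewrite !mulr_ge0.
move=> x y; rewrite -scalerBr -mulmxBr normrZ -mulrA ler_wpM2l //.
have -> : x - t - (y - t) = x - y by rewrite opprB addrA subrK.
exact: mulmx_norm.
Qed.

Lemma pid_quadratic (R : realType) s m (x : 'cV[R]_s) :
  dotv x (pid_mx m *m x) = \sum_(i < s | (i < m)%N) (x i 0) ^+ 2.
Proof.
rewrite dotvE [RHS]big_mkcond; apply: eq_bigr => i _.
rewrite mxE (bigD1 i) //= big1 ?addr0; last first.
  by move=> j ji; rewrite mxE eq_sym (inj_eq val_inj) (negbTE ji) mul0r.
by rewrite mxE eqxx /=; case: ifP => _; rewrite ?mul1r ?mul0r ?mulr0 // expr2.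
Qed.

Lemma scaled_norm_le (R : realType) s (V12 : 'M[R]_s) (x h : 'cV[R]_s) (b : R) : 0 < b ->
  b *: h = V12 *m x -> `|h| <= b^-1 * (s%:R * `|V12| * `|x|).
Proof.
move=> b0 E; have -> : h = b^-1 *: (V12 *m x).
  by rewrite -E scalerA mulVf ?scale1r // lt0r_neq0.
by rewrite normrZ gtr0_norm ?invr_gt0 // ler_wpM2l ?invr_ge0 ?(ltW b0) // mulmx_norm.
Qed.

Theorem theorem2p3 (R : realType) (s m : nat) (M : set 'cV[R]_s)
  (t mu : 'cV[R]_s) (Ptan : 'M[R]_s) (nu : 'cV[R]_s -> 'cV[R]_s)
  (d : measure_display) (Omega : measurableType d) (P : probability Omega R)
  (d' : measure_display) (Omega' : measurableType d') (P' : probability Omega' R)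
  (tt : nat -> Omega -> 'cV[R]_s) (a : nat -> R)
  (V V12 W12 : 'M[R]_s) (Z : Omega' -> 'cV[R]_s)
  (mut : nat -> Omega -> 'cV[R]_s) :
  @submanifold R s m M -> compact M ->
  ~ cutlocus M t -> nearest M t mu ->
  is_tan_proj M mu Ptan ->
  normal_field M nu -> nu mu = t - mu ->
  (forall n, rand_vec (tt n)) ->
  (forall n, 0 < a n) -> a n @[n --> \oo] --> +oo ->
  spd V -> is_sqrtm V V12 ->
  rand_vec Z ->
  cvg_dist P P' (fun n w => a n *: (invmx V12 *m (tt n w - t))) Z ->
  (forall n, rand_vec (mut n)) -> (forall n w, nearest M (tt n w) (mut n w)) ->
  let Pnor := 1%:M - Ptan in
  let G := mx_of (fun x => x - weingarten Ptan nu mu (Ptan *m x)) in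
  let Wm := Pnor + Ptan *m V *m Ptan in
  is_sqrtm Wm W12 ->
  (* 1. *)
  cvg_prob0 P (fun n w => enorm (mut n w - mu)) /\
  (spherical P' Z ->
   let Zn := fun n w => a n *: (invmx V12 *m (tt n w - t)) in
   let L := fun n w => a n *: (invmx W12 *m G *m (mut n w - mu)) in
   (* 2. *)
   (cvg_prob0 P (fun n w => enorm (L n w - (invmx W12 *m Ptan *m V12) *m Zn n w))
    /\ cvg_dist P P' L (fun w => Ptan *m Z w)) /\
   (* 3. *)
   cvg_dist P P'
     (fun n w => a n ^+ 2 *
        ((mut n w - mu)^T *m G *m invmx Wm *m G *m (mut n w - mu)) 0 0)
     (fun w => \sum_(i < s | (i < m)%N) (Z w i 0) ^+ 2)).
Proof.
move=> sub cM ncut nmu HP Nnu nut mtt a0 aoo spdV sqV mZ.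
set X := fun n w => a n *: (invmx V12 *m (tt n w - t)).
move=> XZ mmut nmut Pnor G Wm sqW.
have [Pt PP _] := HP.
have [rP Gt cons lin] := nearest_linearization sub cM ncut nmu HP Nnu nut.
rewrite -/G in Gt lin.
have V12u := spd_unitmx sqV.1.
have W12u := spd_unitmx sqW.1.
have W12t : W12^T = W12 by case: sqW => -[].
pose A := invmx W12 *m Ptan *m V12.
have AAt : A *m A^T = Ptan := sqrtm_projector Pt PP sqV sqW.
have mX n : rand_vec (X n).
  by apply: (rand_vec_comp (f := fun x => a n *: (invmx V12 *m (x - t)))) => //; exact: affine_continuous.
have aX n w : a n *: (tt n w - t) = V12 *m X n w.
  by rewrite /X -scalemxAr mulKVmx.
have hX n w := scaled_norm_le (a0 n) (aX n w).
have tight := cvg_dist_tight mX mZ XZ.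
(* From [a n (tt n - t) = V12 X n]: the distance is at most a multiple of [K / a n], uniformly in
   [w]. *)
have small (K e : R) : 0 < K -> 0 < e -> \forall n \near \oo,
    forall w, `|X n w| < K -> `|tt n w - t| <= e.
  move=> K0 e0; move/cvgryPge : aoo => /(_ (s%:R * `|V12| * K / e)).
  apply: filterS => n an w Xw; apply: le_trans (hX n w) _.
  rewrite mulrC ler_pdivrMr //; rewrite ler_pdivrMr // in an.
  rewrite [leRHS]mulrC; apply: le_trans _ an; rewrite ler_wpM2l ?mulr_ge0 //; exact: ltW.
have s1 : 0 < s%:R + 1 :> R by rewrite ltr_wpDl.
have menorm (Y : Omega -> 'cV[R]_s) : rand_vec Y -> measurable_fun setT (fun w => enorm (Y w)).
  by move=> mY; apply: measurable_comp_continuous => //; exact: enorm_continuous.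
split.
  apply: (cvg_prob0_tight mX) tight _ => [n|K eps K0 eps0].
    apply: menorm; apply: (rand_vec_comp (f := fun x => x - mu)) => //.
    apply: (@lipschitz_continuous_at _ _ _ _ 1) => // x y.
    by rewrite mul1r opprB addrA subrK.
  have [dl dl0 Hd] := cons _ (divr_gt0 eps0 s1).
  apply: filterS (small K dl K0 dl0) => n Hn w /Hn/Hd /(_ (nmut n w)) h.
  rewrite ger0_norm ?enorm_ge0 //; apply: le_lt_trans (enorm_le_norm _) _.
  apply: le_lt_trans (ler_wpM2l _ h) _ => //.
  by rewrite mulrA ltr_pdivrMr // mulrC ltr_pM2l // ltrDl.
move=> sZ Zn L.
have mL n : rand_vec (L n).
  by apply: (rand_vec_comp (f := fun x => a n *: (invmx W12 *m G *m (x - mu)))) => //; exact: affine_continuous.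
have LX : cvg_prob0 P (fun n w => enorm (L n w - A *m X n w)).
  apply: (cvg_prob0_tight mX) tight _ => [n|K eps K0 eps0].
    apply: menorm => i j; under eq_fun do rewrite mxE [X in _ + X]mxE.
    apply: measurable_funB; first exact: mL.
    by apply: (rand_vec_comp (f := mulmx A)) => //; exact: mulmx_continuous.
  (* Collects the factors from the Euclidean norm, from [invmx W12] and from the bound on
     [a n |tt n - t|]; the precision asked of the linearization is [eps / (Q + 1)]. *)
  pose Q := s%:R * (s%:R * `|invmx W12| * (s%:R * `|V12| * K)).
  have Q0 : 0 <= Q by rewrite !mulr_ge0 // ltW.
  have Q1 : 0 < Q + 1 by rewrite ltr_wpDl.
  have [dl dl0 Hd] := lin _ (divr_gt0 eps0 Q1).
  apply: filterS (small K dl K0 dl0) => n Hn w Xw.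
  have := Hd _ _ (Hn w Xw) (nmut n w).
  set u := mut n w - mu; set h := tt n w - t => Gu.
  have -> : L n w - A *m X n w = a n *: (invmx W12 *m (G *m u - Ptan *m h)).
    rewrite /L /A -(mulmxA _ V12) -aX -/h -/u -scalemxAr -scalerBr.
    by rewrite [in RHS]mulmxBr !mulmxA.
  rewrite ger0_norm ?enorm_ge0 //; apply: le_lt_trans (enorm_le_norm _) _.
  rewrite normrZ gtr0_norm //.
  have ah : a n * `|h| <= s%:R * `|V12| * K.
    rewrite mulrC -ler_pdivlMr //; apply: le_trans (hX n w) _.
    rewrite mulrC ler_wpM2r ?invr_ge0 ?(ltW (a0 n)) //.
    by rewrite ler_wpM2l ?mulr_ge0 // ltW.
  apply: (@le_lt_trans _ _ (eps / (Q + 1) * Q)); last first.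
    by rewrite mulrAC ltr_pdivrMr // ltr_pM2l // ltrDl.
  have -> : eps / (Q + 1) * Q = s%:R * (s%:R * `|invmx W12| * (eps / (Q + 1) * (s%:R * `|V12| * K))).
    by rewrite {2}/Q; ring.
  rewrite ler_wpM2l //.
  apply: (@le_trans _ _ (a n * (s%:R * `|invmx W12| * (eps / (Q + 1) * `|h|)))).
    rewrite ler_wpM2l ?(ltW (a0 n)) //; apply: le_trans (mulmx_norm _ _) _.
    by rewrite ler_wpM2l ?mulr_ge0.
  rewrite mulrCA ler_wpM2l ?mulr_ge0 // mulrCA ler_wpM2l //.
  by rewrite divr_ge0 ?ltW.
(* The limit is first [A Z] with [A = Ptan H]; as [f (Ptan x)] is itself a bounded continuous test
   function, sphericity removes [H]. *)
have cL : cvg_dist P P' L (fun w => Ptan *m Z w).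
  have cLA := cvg_dist_slutsky mX mZ mL XZ LX.
  have [H [HH AH]] := partial_isometry_extend Pt PP AAt.
  move=> f cf bf; have := cLA f cf bf; have [C bC] := bf.
  under [in X in _ --> X -> _]eq_integral do rewrite AH -mulmxA.
  rewrite (spherical_integral (f := fun x => f (Ptan *m x)) (C := C) mZ sZ HH) //.
  by move=> x; apply: continuous_comp; [exact: mulmx_continuous | exact: cf].
split; first by split.
move=> f cf [C bf].
(* Symmetry of [G] and [W12], together with [Wm = W12 *m W12], makes the quadratic form the squared
   length of [L]. *)
have LL n w : a n ^+ 2 * ((mut n w - mu)^T *m G *m invmx Wm *m G *m (mut n w - mu)) 0 0
    = dotv (L n w) (L n w).
  have -> : invmx Wm = invmx W12 *m invmx W12.
    rewrite -sqW.2; apply: (can_inj (mulKmx W12u)); apply: (can_inj (mulKmx W12u)).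
    by rewrite mulKVmx // mulmxV // mulmxA mulmxV // unitmx_mul W12u.
  rewrite /L dotvZl dotvZr /dotv !trmx_mul Gt trmx_inv W12t expr2 -mulrA.
  by rewrite !mulmxA.
under eq_fun do under eq_integral do rewrite LL.
have [H [HH PH]] := projector_diag Pt PP rP sub.1.
have Pq w : dotv (Ptan *m Z w) (Ptan *m Z w) = dotv (H *m Z w) (pid_mx m *m (H *m Z w)).
  by rewrite (dotv_mulmxl Ptan) Pt mulmxA PP PH -!mulmxA -(dotv_mulmxl H).
have cfq : continuous (fun x : 'cV[R]_s => f (dotv x (pid_mx m *m x))).
  by move=> x; apply: continuous_comp; [exact: quadratic_continuous | exact: cf].
have cfd : continuous (fun x : 'cV[R]_s => f (dotv x x)).
  by move=> x; apply: continuous_comp; [exact: dotv_continuous | exact: cf].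
(* Composing the test function with the squared length reduces claim 3 to claim 2. *)
have := cL _ cfd (ex_intro _ C (fun x => bf _)).
under [in X in _ --> X -> _]eq_integral do rewrite Pq.
rewrite (spherical_integral (f := fun x => f (dotv x (pid_mx m *m x))) (C := C) mZ sZ HH) //.
by under [in X in _ --> X -> _]eq_integral do rewrite pid_quadratic.
Qed.
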